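(* Let $\sigma$ be a cone in $V$, let $\tau\preceq\sigma$ be a face, and let $\Delta_\tau$ be the transversal fan of $\tau$ in $\Delta:=\langle\sigma\rangle$. Then $$P_\sigma(t)\;\ge\;P_\tau(t)\cdot P_{\Delta_\tau}(t),$$ where $P\ge Q$ means that the corresponding inequality holds between the coefficients of the monomials of the same degree in $P$ and $Q$.
   Context: $V$ is a real vector space of finite dimension. A cone in $V$ is a strictly convex polyhedral cone: a finite intersection $\sigma=\bigcap_i H_{\alpha_i}$ of half-spaces $H_\alpha=\{v:\alpha(v)\ge0\}$ ($\alpha$ a nonzero linear form) with $\bigcap_i\ker\alpha_i=\{0\}$. $V_\sigma:=\sigma+(-\sigma)$, $o=\{0\}$. A face $\tau\preceq\sigma$ is $\sigma\cap\ker\beta$ with $\beta\in V^*$, $\sigma\subset H_\beta$. A fan is a nonempty finite set of cones containing all faces of its members such that the intersection of any two members is a face of both. A subfan is a subset which is a fan. $\langle\sigma\rangle$ is the fan of all faces of $\sigma$, $\partial\sigma=\langle\sigma\rangle\setminus\{\sigma\}$. Transversal fan: for a cone $\tau$ of a fan $\Delta$, $\Delta_\tau:=\{p(\gamma):\tau\preceq\gamma\in\Delta\}$, a fan in $V/V_\tau$, with $p:V\to V/V_\tau$ the quotient map. Fan space: the open sets of a fan $\Delta$ are the subfans (and $\emptyset$). A sheaf $\mathcal F$ on $\Delta$ is the same as a collection $\mathcal F(\sigma):=\mathcal F(\langle\sigma\rangle)$, $\sigma\in\Delta$, with functorial restriction maps for $\tau\preceq\sigma$. Write $F_\Lambda=\mathcal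 F(\Lambda)$, $F_\sigma=\mathcal F(\sigma)$. $A^\bullet=S^\bullet(V^* )$ with $A^{2q}=S^q(V^* )$, $\mathfrak m=A^{>0}$, $\mathbb R^\bullet=A^\bullet/\mathfrak m$; $\overline F{}^\bullet:=F^\bullet/\mathfrak mF^\bullet$ for a graded $A^\bullet$-module. $A_\sigma^\bullet:=S^\bullet(V_\sigma^* )$ graded likewise; $\mathcal A^\bullet$ is the sheaf with $\mathcal A^\bullet(\sigma)=A^\bullet_\sigma$ and natural restrictions. A minimal extension sheaf on $\Delta$ is a sheaf $\mathcal E^\bullet$ of graded $\mathcal A^\bullet$-modules such that: (N) $E^\bullet_o\cong\mathbb R^\bullet$; (PF) $E^\bullet_\sigma$ is a free $A^\bullet_\sigma$-module for each $\sigma\in\Delta$; (LME) for each $\sigma\in\Delta\setminus\{o\}$ the restriction $E^\bullet_\sigma\to E^\bullet_{\partial\sigma}$ induces an isomorphism $\overline E{}^\bullet_\sigma\cong\overline E{}^\bullet_{\partial\sigma}$. It exists, is unique up to isomorphism, and vanishes in odd degrees. $P_\Delta(t)=\sum_q\dim\overline E{}^{2q}_\Delta\,t^{2q}$ for a fan $\Delta$ in $V$ with minimal extension sheaf $\mathcal E^\bullet$; $P_\sigma:=P_{\langle\sigma\rangle}$. For $\Delta_\tau$ the definitions are applied with ambient space $V/V_\tau$. *)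

(* Defs.v *)
From HB Require Import structures.
From mathcomp Require Import all_boot all_order all_algebra.
From mathcomp Require Import boolp classical_sets functions reals.
Set Implicit Arguments.
Unset Strict Implicit.
Unset Printing Implicit Defensive.
Import Order.TTheory GRing.Theory Num.Theory.
Local Open Scope classical_set_scope.
Local Open Scope ring_scope.

Section Cones.
Variables (R : realType) (V : vectType R).
Implicit Types (sigma tau : set V).

Definition halfspace (alpha : 'Hom(V, R^o)) : set V :=
  [set v | 0 <= (alpha v : R)].

Definition is_cone sigma : Prop :=
  exists (n : nat) (alpha : 'I_n -> 'Hom(V, R^o)),
    [/\ forall i, alpha i != 0,
        sigma = [set v | forall i, halfspace (alpha i) v] &
        forall v, (forall i, v \in lker (alpha i)) -> v = 0].

Definition face tau sigma : Prop :=
  exists2 beta : 'Hom(V, R^o), sigma `<=` halfspace beta &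
    tau = sigma `&` [set v | v \in lker beta].

Definition face_fan sigma : set (set V) := [set tau | face tau sigma].

Lemma set_vspace (D : set V) : D 0 ->
    (forall (a : R) x y, D x -> D y -> D (a *: x + y)) ->
  exists U : {vspace V}, [set v | v \in U] = D.
Proof.
move=> D0 DP.
pose P n := `[< exists2 U : {vspace V}, [set v | v \in U] `<=` D & \dim U = n >].
have P0 : exists n, P n.
  exists 0%N; apply/asboolP; exists 0%VS; last exact: dimv0.
  by move=> v /=; rewrite memv0 => /eqP ->.
have Pb n : P n -> (n <= \dim {:V})%N.
  by move=> /asboolP [U _ <-]; rewrite dimvS // subvf.
have [m /asboolP [U UD Um] maxm] := ex_maxnP P0 Pb.
exists U; apply/seteqP; split=> // v Dv /=; apply: contrapT => /negP vU.
have /maxm : P (\dim (<[v]> + U)%VS).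
  apply/asboolP; exists (<[v]> + U)%VS => // w /= /memv_addP[x /vlineP[a ->]].
  by move=> [y yU ->]; apply: DP => //; apply: UD.
rewrite -Um leqNgt => /negP; apply.
rewrite (ltn_leqif (dimv_leqif_sup (addvSr _ _))).
by apply: contra vU => /subvP; apply; apply: (subvP (addvSl _ _)); apply: memv_line.
Qed.

(* The linear hull of sigma; for a cone it is sigma + (- sigma), see
   cone_spanP below. *)
Definition cone_span sigma : {vspace V} :=
  xget 0%VS [set U : {vspace V} |
    [set v | v \in U] =
    [set v | forall U' : {vspace V}, sigma `<=` [set w | w \in U'] -> v \in U']].

Lemma mem_cone_span sigma v :
  v \in cone_span sigma <->
  forall U : {vspace V}, sigma `<=` [set w | w \in U] -> v \in U.
Proof.
rewrite /cone_span; set D := [set v | forall U', _].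
have [||U UD] := @set_vspace D.
- by move=> U _; apply: mem0v.
- by move=> a x y Dx Dy U sU; rewrite memvD ?memvZ //; [apply: Dx|apply: Dy].
have /= e := xgetPex 0%VS (ex_intro
  (fun U : {vspace V} => [set v | v \in U] = D) U UD).
by have -> : v \in xget 0%VS [set U0 | [set v0 | v0 \in U0] = D] = D v :> Prop :=
  congr1 (@^~ v) e.
Qed.

Lemma cone_spanS sigma tau : tau `<=` sigma ->
  (cone_span tau <= cone_span sigma)%VS.
Proof.
move=> ts; apply/subvP => v /mem_cone_span tv; apply/mem_cone_span => U sU.
by apply: tv => w /ts /sU.
Qed.

Lemma cone_spanP sigma : is_cone sigma -> forall v,
  v \in cone_span sigma <-> exists x y, [/\ sigma x, sigma y & v = x - y].
Proof.
move=> [n [alpha [_ -> _]]] v; set S := [set v | forall i, _].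
have S0 : S 0 by move=> i; rewrite /halfspace /= linear0.
have SD x y : S x -> S y -> S (x + y).
  move=> Sx Sy i; rewrite /halfspace /= linearD addr_ge0 //.
    exact: Sx.
  exact: Sy.
have SZ (a : R) x : 0 <= a -> S x -> S (a *: x).
  by move=> a0 Sx i; rewrite /halfspace /= linearZ mulr_ge0 //; apply: Sx.
split; last first.
  move=> [x [y [Sx Sy ->]]]; apply/mem_cone_span => U SU.
  by rewrite memvB //; apply: SU.
have [||U UD] :=
    @set_vspace [set v | exists x y, [/\ S x, S y & v = x - y]].
- by exists 0, 0; rewrite subr0.
- move=> a _ _ [x [y [Sx Sy ->]]] [x' [y' [Sx' Sy' ->]]].
  have [a0|a0] := leP 0 a.
    exists (a *: x + x'), (a *: y + y'); split; [| |
      by rewrite scalerBr [in RHS]opprD addrACA];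
      by apply: SD => //; apply: SZ.
  have a0' : 0 <= - a by rewrite oppr_ge0 ltW.
  exists ((- a) *: y + x'), ((- a) *: x + y'); split; [| |
    by rewrite !scaleNr scalerBr [in RHS]opprD opprK [in RHS]addrACA
      [in RHS](addrC (- _))];
    by apply: SD => //; apply: SZ.
move=> /mem_cone_span /(_ U) vU.
suff : [set v | v \in U] v by rewrite UD.
apply: vU; rewrite UD => x Sx; by exists x, 0; rewrite subr0.
Qed.

End Cones.

(* p stands for the projection of V onto a quotient W of V by V_tau. *)
Definition transversal_fan (R : realType) (V W : vectType R) (p : 'Hom(V, W))
    (Delta : set (set V)) (tau : set V) : set (set W) :=
  [set p @` gamma | gamma in [set gamma | Delta gamma /\ face tau gamma]].

(* S(W^* ) is realized as the algebra of real polynomial functions on W, i.e.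
   the subalgebra of the functions W -> R generated by the linear forms; the
   canonical map is an isomorphism since R is infinite. *)
Section PolynomialFunctions.
Variables (R : realType).

Inductive polynomial (W : vectType R) : (W -> R) -> Prop :=
| polynomial_cst c : polynomial (fun=> c)
| polynomial_form (l : 'Hom(W, R^o)) : polynomial l
| polynomial_add f g : polynomial f -> polynomial g -> polynomial (f \+ g)
| polynomial_mul f g : polynomial f -> polynomial g -> polynomial (f \* g).

Record polyfun (W : vectType R) := PolyFun {
  polyfun_val :> W -> R;
  polyfunP : `[< polynomial polyfun_val >] }.

HB.instance Definition _ (W : vectType R) := [isSub for @polyfun_val W].
HB.instance Definition _ (W : vectType R) := [Choice of polyfun W by <:].

Definition polynomial_pred (W : vectType R) : {pred W -> R} :=
  fun f => `[< polynomial f >].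

Lemma polynomial_subring W : subring_closed (@polynomial_pred W).
Proof.
split; first exact/asboolP/polynomial_cst.
- move=> f g /asboolP Pf /asboolP Pg; apply/asboolP.
  rewrite (_ : f - g = f \+ ((fun=> -1) \* g)).
    by apply: polynomial_add => //; apply: polynomial_mul => //;
      apply: polynomial_cst.
  by apply/funext => x /=; rewrite mulN1r.
- by move=> f g /asboolP Pf /asboolP Pg; apply/asboolP; apply: polynomial_mul.
Qed.

HB.instance Definition _ (W : vectType R) :=
  GRing.SubChoice_isSubComPzRing.Build (W -> R) (@polynomial_pred W)
    (polyfun W) (@polynomial_subring W).

Section PolyfunLmodule.
Variable W : vectType R.

Definition polyfun_scale (a : R) (f : polyfun W) : polyfun W :=
  PolyFun (asboolT (polynomial_mul (polynomial_cst W a) (asboolW (polyfunP f)))).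

Lemma polyfun_scaleA a b f :
  polyfun_scale a (polyfun_scale b f) = polyfun_scale (a * b) f.
Proof. by apply/val_inj/funext => x /=; rewrite mulrA. Qed.
Lemma polyfun_scale1 : left_id 1 polyfun_scale.
Proof. by move=> f; apply/val_inj/funext => x /=; rewrite mul1r. Qed.
Lemma polyfun_scaleDr : right_distributive polyfun_scale +%R.
Proof. by move=> a f g; apply/val_inj/funext => x /=; rewrite mulrDr. Qed.
Lemma polyfun_scaleDl f : {morph polyfun_scale^~ f : a b / a + b}.
Proof. by move=> a b; apply/val_inj/funext => x /=; rewrite mulrDl. Qed.
HB.instance Definition _ := GRing.Zmodule_isLmodule.Build R (polyfun W)
  polyfun_scaleA polyfun_scale1 polyfun_scaleDr polyfun_scaleDl.

End PolyfunLmodule.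

Lemma polyfun1_neq0 W : (1 : polyfun W) != 0.
Proof.
apply/eqP => /(congr1 (fun f : polyfun W => f 0)) /eqP.
by rewrite /= (negbTE (oner_neq0 R)).
Qed.
HB.instance Definition _ (W : vectType R) :=
  GRing.PzSemiRing_isNonZero.Build (polyfun W) (@polyfun1_neq0 W).

Lemma polyfun_scaleAl W (a : R) (f g : polyfun W) : a *: (f * g) = a *: f * g.
Proof. by apply/val_inj/funext => x /=; rewrite mulrA. Qed.
HB.instance Definition _ (W : vectType R) :=
  GRing.Lmodule_isLalgebra.Build R (polyfun W) (@polyfun_scaleAl W).
HB.instance Definition _ (W : vectType R) :=
  GRing.Lalgebra_isComAlgebra.Build R (polyfun W).

Section Pullback.
Variables (U W : vectType R) (h : {linear U -> W}).

Lemma polynomial_comp (f : W -> R) : polynomial f -> polynomial (f \o h).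
Proof.
elim=> [c|l|f1 f2 _ IH1 _ IH2|f1 f2 _ IH1 _ IH2].
- exact: polynomial_cst.
- rewrite (_ : l \o h = (l \o linfun h)%VF).
    exact: polynomial_form.
  by apply/funext => x; rewrite /= comp_lfunE lfunE.
- exact: polynomial_add.
- exact: polynomial_mul.
Qed.

Definition pullback (f : polyfun W) : polyfun U :=
  PolyFun (asboolT (polynomial_comp (asboolW (polyfunP f)))).

Lemma pullback_zmod : zmod_morphism pullback.
Proof. by move=> f g; apply/val_inj/funext. Qed.
Lemma pullback_monoid : monoid_morphism pullback.
Proof. by split=> [|f g]; apply/val_inj/funext. Qed.
HB.instance Definition _ := GRing.isZmodMorphism.Build _ _ pullback
  pullback_zmod.
HB.instance Definition _ := GRing.isMonoidMorphism.Build _ _ pullback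
  pullback_monoid.

End Pullback.

(* S^q(W^* ), of degree 2q in the grading used for modules *)
Definition homog (W : vectType R) (q : nat) : set (polyfun W) :=
  [set f | exists (n : nat) (c : 'I_n -> R) (l : 'I_n -> 'I_q -> 'Hom(W, R^o)),
     forall x, f x = \sum_(i < n) c i * \prod_(j < q) (l i j x : R)].

(* the ideal of elements of positive degree *)
Definition max_ideal (W : vectType R) : set (polyfun W) :=
  [set a | exists (n : nat) (b : 'I_n -> polyfun W),
     (forall i, exists2 q, (0 < q)%N & homog q (b i)) /\ a = \sum_i b i].

End PolynomialFunctions.

Section GradedModules.
Variables (R : realType) (W : vectType R).
Local Notation S := (polyfun W).

Record is_grading (M : lmodType S) (gr : int -> set M) : Prop := IsGrading {
  grading0 : forall k, gr k 0;
  gradingB : forall k x y, gr k x -> gr k y -> gr k (x - y);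
  gradingZ : forall q k (a : S) x, homog q a -> gr k x ->
    gr (k + (2 * q)%:Z) (a *: x);
  grading_gen : forall x, exists (s : seq int) (c : int -> M),
    (forall k, gr k (c k)) /\ x = \sum_(k <- s) c k;
  grading_free : forall (s : seq int) (c : int -> M), uniq s ->
    (forall k, gr k (c k)) -> \sum_(k <- s) c k = 0 ->
    forall k, k \in s -> c k = 0 }.

Record gmodule := GModule {
  gmodule_sort :> lmodType S;
  gmodule_deg : int -> set gmodule_sort;
  gmoduleP : is_grading gmodule_deg }.

(* isomorphism of graded modules onto R = S / S^{>0}, on which a acts as a(0) *)
Definition iso_trivial (M : gmodule) : Prop :=
  exists f : {additive M -> R},
    [/\ bijective f, forall (a : S) x, f (a *: x) = a 0 * f x &
        forall k x, gmodule_deg k x -> k != 0 -> f x = 0].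

(* the submodule m M *)
Definition max_mul (M : lmodType S) : set M :=
  [set x | exists (n : nat) (a : 'I_n -> S) (y : 'I_n -> M),
     (forall i, max_ideal (a i)) /\ x = \sum_i a i *: y i].

(* the linear map M / m M -> N / m N induced by f is bijective *)
Definition bar_bijective (M N : lmodType S) (f : {linear M -> N}) : Prop :=
  (forall x, max_mul (f x) -> max_mul x) /\
  (forall y, exists x, max_mul (y - f x)).

(* b induces an R-basis of the image of D in M / m M *)
Definition bar_basis (M : lmodType S) (D : set M) (d : nat) (b : 'I_d -> M) :
    Prop :=
  [/\ forall i, D (b i),
      forall c : 'I_d -> R, max_mul (\sum_i (c i)%:A *: b i) ->
        forall i, c i = 0 &
      forall x, D x -> exists c : 'I_d -> R,
        max_mul (x - \sum_i (c i)%:A *: b i)].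

(* 0 if the dimension is infinite *)
Definition bar_dim (M : lmodType S) (D : set M) : nat :=
  xget 0%N [set d | exists b : 'I_d -> M, bar_basis D b].

End GradedModules.

Definition free_module (A : pzRingType) (M : lmodType A) : Prop :=
  exists B : set M,
    (forall x, exists (n : nat) (a : 'I_n -> A) (b : 'I_n -> M),
       (forall i, B (b i)) /\ x = \sum_i a i *: b i) /\
    (forall (n : nat) (a : 'I_n -> A) (b : 'I_n -> M), injective b ->
       (forall i, B (b i)) -> \sum_i a i *: b i = 0 -> forall i, a i = 0).

#[local] Obligation Tactic := idtac.

Section Sheaves.
Variables (R : realType) (V : vectType R).

Local Notation Sym sigma := (polyfun (subvs_of (cone_span sigma))).

Definition to_cone (sigma : set V) : polyfun V -> Sym sigma :=
  pullback (vsval : {linear subvs_of (cone_span sigma) -> V}).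
HB.instance Definition _ sigma := GRing.RMorphism.on (to_cone sigma).

(* For a face tau of sigma, vsproj is applied to vectors of V_tau, hence of
   V_sigma, so this is restriction of functions from V_sigma to V_tau. *)
Definition to_face (sigma tau : set V) : Sym sigma -> Sym tau :=
  pullback (vsproj (cone_span sigma) \o (vsval : subvs_of (cone_span tau) -> V)).
HB.instance Definition _ sigma tau := GRing.RMorphism.on (@to_face sigma tau).

Lemma to_face_to_cone (sigma tau : set V) (a : polyfun V) : face tau sigma ->
  to_face tau (to_cone sigma a) = to_cone tau a.
Proof.
move=> [beta _ tauE]; apply/val_inj/funext => x /=; congr (a _).
rewrite vsprojK //; apply: (subvP (cone_spanS (tau := tau) _)).
  by rewrite tauE => v [].
exact: subvsP.
Qed.

Variable Delta : set (set V).

(* Sheaf of graded modules on the fan space of Delta, given by its values on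
   the cones of Delta; Delta is meant to be a fan, though no definition needs it.
   [sheaf_res sigma tau] is meaningful only if tau is a face of sigma. *)
Record gsheaf := GSheaf {
  stalk :> forall sigma : Delta, gmodule (subvs_of (cone_span (val sigma)));
  sheaf_res : forall sigma tau : Delta, {additive stalk sigma -> stalk tau};
  sheaf_resZ : forall sigma tau : Delta, face (val tau) (val sigma) ->
    forall (a : Sym (val sigma)) (x : stalk sigma),
    sheaf_res sigma tau (a *: x) = to_face (val tau) a *: sheaf_res sigma tau x;
  sheaf_res_deg : forall sigma tau : Delta, face (val tau) (val sigma) ->
    forall k (x : stalk sigma), gmodule_deg k x ->
    gmodule_deg k (sheaf_res sigma tau x);
  sheaf_res_id : forall (sigma : Delta) (x : stalk sigma),
    sheaf_res sigma sigma x = x;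
  sheaf_res_comp : forall sigma tau rho : Delta,
    face (val tau) (val sigma) -> face (val rho) (val tau) ->
    forall x : stalk sigma,
    sheaf_res tau rho (sheaf_res sigma tau x) = sheaf_res sigma rho x }.

Variable E : gsheaf.

(* E(Lambda) for a subset Lambda of Delta: compatible families indexed by
   Lambda, extended by 0 outside Lambda *)
Record section (Lambda : set Delta) := Section {
  section_val :> forall gamma : Delta, E gamma;
  section_res : forall gamma gamma' : Delta, Lambda gamma -> Lambda gamma' ->
    face (val gamma') (val gamma) ->
    sheaf_res E gamma gamma' (section_val gamma) = section_val gamma';
  section_out : forall gamma : Delta, ~ Lambda gamma -> section_val gamma = 0 }.

Lemma section_inj Lambda (s t : section Lambda) :
  (forall gamma, s gamma = t gamma) -> s = t.
Proof.
case: s t => s sr so [t tr to] /= st.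
have e : s = t by apply: functional_extensionality_dep.
by case: t / e tr to {st} => tr to; congr Section; apply: Prop_irrelevance.
Qed.

HB.instance Definition _ Lambda := gen_eqMixin (section Lambda).
HB.instance Definition _ Lambda := gen_choiceMixin (section Lambda).

Section SectionModule.
Variable Lambda : set Delta.
Implicit Types s t : section Lambda.

Program Definition section0 : section Lambda := @Section Lambda (fun=> 0) _ _.
Next Obligation. by move=> * /=; rewrite raddf0. Qed.
Next Obligation. by []. Qed.

Program Definition section_opp s : section Lambda :=
  @Section Lambda (fun gamma => - s gamma) _ _.
Next Obligation. by move=> s * /=; rewrite raddfN section_res. Qed.
Next Obligation. by move=> s * /=; rewrite section_out // oppr0. Qed.

Program Definition section_add s t : section Lambda :=
  @Section Lambda (fun gamma => s gamma + t gamma) _ _.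
Next Obligation. by move=> s t * /=; rewrite raddfD !section_res. Qed.
Next Obligation. by move=> s t * /=; rewrite !section_out // addr0. Qed.

Program Definition section_scale (a : polyfun V) s : section Lambda :=
  @Section Lambda (fun gamma => to_cone (val gamma) a *: s gamma) _ _.
Next Obligation.
by move=> a s * /=; rewrite sheaf_resZ // to_face_to_cone // section_res.
Qed.
Next Obligation. by move=> a s * /=; rewrite section_out // scaler0. Qed.

Lemma section_addA : associative section_add.
Proof. by move=> s t u; apply: section_inj => ? /=; rewrite addrA. Qed.
Lemma section_addC : commutative section_add.
Proof. by move=> s t; apply: section_inj => ? /=; rewrite addrC. Qed.
Lemma section_add0 : left_id section0 section_add.
Proof. by move=> s; apply: section_inj => ? /=; rewrite add0r. Qed.
Lemma section_addN : left_inverse section0 section_opp section_add.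
Proof. by move=> s; apply: section_inj => ? /=; rewrite addNr. Qed.
HB.instance Definition _ := GRing.isZmodule.Build (section Lambda)
  section_addA section_addC section_add0 section_addN.

Lemma section_scaleA a b s :
  section_scale a (section_scale b s) = section_scale (a * b) s.
Proof. by apply: section_inj => ? /=; rewrite scalerA rmorphM. Qed.
Lemma section_scale1 : left_id 1 section_scale.
Proof. by move=> s; apply: section_inj => ? /=; rewrite rmorph1 scale1r. Qed.
Lemma section_scaleDr : right_distributive section_scale +%R.
Proof. by move=> a s t; apply: section_inj => ? /=; rewrite scalerDr. Qed.
Lemma section_scaleDl s : {morph section_scale^~ s : a b / a + b}.
Proof. by move=> a b; apply: section_inj => ? /=; rewrite rmorphD scalerDl. Qed.
HB.instance Definition _ := GRing.Zmodule_isLmodule.Build (polyfun V)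
  (section Lambda) section_scaleA section_scale1 section_scaleDr
  section_scaleDl.

Definition section_deg (k : int) : set (section Lambda) :=
  [set s | forall gamma, gmodule_deg k (s gamma)].

End SectionModule.

Section SectionRestriction.
Variables (Lambda Lambda' : set Delta) (sub : Lambda `<=` Lambda').

Program Definition section_restr (s : section Lambda') : section Lambda :=
  @Section Lambda (fun gamma => if `[< Lambda gamma >] then s gamma else 0) _ _.
Next Obligation.
move=> s gamma gamma' /= L L' f; rewrite !asboolT //.
by rewrite section_res //; apply: sub.
Qed.
Next Obligation. by move=> s gamma /= L; rewrite asboolF. Qed.

Lemma section_restr_linear : linear section_restr.
Proof.
move=> a s t; apply: section_inj => gamma /=.
by case: ifP => // _; rewrite scaler0 addr0.
Qed.
HB.instance Definition _ := GRing.isLinear.Build (polyfun V) (section Lambda')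
  (section Lambda) _ section_restr section_restr_linear.

End SectionRestriction.

Definition faces (sigma : Delta) : set Delta :=
  [set tau | face (val tau) (val sigma)].
Definition boundary (sigma : Delta) : set Delta :=
  faces sigma `\ sigma.

Lemma boundary_sub sigma : boundary sigma `<=` faces sigma.
Proof. exact: subDsetl. Qed.

Record is_minimal_extension : Prop := IsMinimalExtension {
  minimal_N : forall o : Delta, val o = [set 0] -> iso_trivial (E o);
  minimal_PF : forall sigma : Delta, free_module (E sigma);
  minimal_LME : forall sigma : Delta, val sigma <> [set 0] ->
    bar_bijective (section_restr (@boundary_sub sigma)) }.

(* The coefficient of t^k in P_Delta(t), when E is a minimal extension sheaf on
   Delta. The even degrees are those of the grading where linear forms have
   degree 2. *)
Definition poincare (k : nat) : nat :=
  if odd k then 0%N else bar_dim (@section_deg setT k%:Z).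

End Sheaves.

(* Main.v *)
(* Let E be a minimal extension sheaf on <sigma>, H one on Delta_tau, and s a
   linear section of p : V -> W. Restricting functions along p and s turns the
   stalks E_gamma (gamma containing tau) and H_{p gamma} into modules over each
   other's rings. Both families consist of free modules and are flabby, so maps
   given at the bottom cone extend one cone at a time: each element e_j of a
   homogeneous basis of E_tau / m E_tau yields a map phi_j : H -> E with
   phi_j(1) = e_j, and the dual functional of e_j yields psi_j : E -> H. The
   matrix (psi_i phi_j) of endomorphisms of H is the identity at the bottom
   cone; by induction over the cones it is invertible on all stalks (surjective
   by the graded Nakayama lemma, injective because the homogeneous components
   are finite dimensional). Hence the elements phi_j(b), with b in a basis of
   H_{p sigma} / m H_{p sigma}, are linearly independent in E_sigma / m E_sigma.
   This bounds P_sigma below by the product of P_{Delta_tau} and the Poincare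
   polynomial of the stalk E_tau; the same bound with tau = {0} and p = id, for
   the restriction of E to <tau>, shows that the latter is at least P_tau. *)
From HB Require Import structures.
Require Import Defs.
From mathcomp Require Import all_boot all_order all_algebra.
From mathcomp Require Import boolp classical_sets functions reals.
From mathcomp Require Import zify.
Set Implicit Arguments.
Unset Strict Implicit.
Unset Printing Implicit Defensive.
Import Order.TTheory GRing.Theory Num.Theory.
Local Open Scope classical_set_scope.
Local Open Scope ring_scope.

(** * Polynomial functions *)

(** The definitions supply less than a graded argument wants: stalks are graded by all integers, a
    basis given by (PF) need not be homogeneous, (LME) concerns the whole quotients rather than
    their graded pieces, and [bar_dim] is 0 when no finite basis exists. So boundedness below, which
    Nakayama needs, and finiteness in each degree have to be derived. Negative degrees vanish by
    induction on the dimension of the cone. Such an element restricts to zero on the boundary, so by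
    (LME) it is a sum of products $a y$ with $a\in\mathfrak m$ and $y$ of still smaller degree.
    Iterating puts it in $\mathfrak m^N E_\sigma$ for every $N$, and a free module is $\mathfrak
    m$-adically separated. For finiteness, restriction to the boundary has a finite dimensional
    image in degree $k$, and its kernel lies in $\mathfrak m E_\sigma$, whose part of degree $k$
    comes from lower degrees. A lift defined on a non-homogeneous basis is repaired by keeping only
    its component of the wanted degree. *)

Section Polynomials.
Variables (R : realType) (W : vectType R).
Implicit Types (a b : polyfun W) (l : 'Hom(W, R^o)).

Lemma polyfunD a b x : (a + b) x = a x + b x. Proof. by []. Qed.
Lemma polyfunM a b x : (a * b) x = a x * b x. Proof. by []. Qed.
Lemma polyfunZ (c : R) a x : (c *: a) x = c * a x. Proof. by []. Qed.
Lemma polyfunA (c : R) x : (c%:A : polyfun W) x = c.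
Proof. by rewrite /= mulr1. Qed.

Lemma polyfun_eq a b : (forall x, a x = b x) -> a = b.
Proof. by move=> ab; apply/val_inj/funext. Qed.

Lemma polyfun_sum (T : Type) (r : seq T) (P : pred T) (F : T -> polyfun W) x :
  (\sum_(i <- r | P i) F i) x = \sum_(i <- r | P i) F i x.
Proof. exact: (big_morph (fun a : polyfun W => a x)). Qed.

Lemma polyfun_prod (T : Type) (r : seq T) (P : pred T) (F : T -> polyfun W) x :
  (\prod_(i <- r | P i) F i) x = \prod_(i <- r | P i) F i x.
Proof. exact: (big_morph (fun a : polyfun W => a x)). Qed.

Definition form_polyfun l : polyfun W := PolyFun (asboolT (polynomial_form l)).

Lemma homogE q a : homog q a <->
  exists (n : nat) (c : 'I_n -> R) (l : 'I_n -> 'I_q -> 'Hom(W, R^o)),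
    a = \sum_(i < n) c i *: \prod_(j < q) form_polyfun (l i j).
Proof.
split=> -[n [c [l al]]]; exists n, c, l.
  apply: polyfun_eq => x; rewrite al polyfun_sum.
  by apply: eq_bigr => i _; rewrite polyfunZ polyfun_prod.
move=> x; rewrite al polyfun_sum.
by apply: eq_bigr => i _; rewrite polyfunZ polyfun_prod.
Qed.

Lemma homogD q a b : homog q a -> homog q b -> homog q (a + b).
Proof.
move=> /homogE[n [c [l ->]]] /homogE[n' [c' [l' ->]]]; apply/homogE.
exists (n + n')%N, (fun i => match fintype.split i with inl j => c j | inr j => c' j end).
exists (fun i => match fintype.split i with inl j => l j | inr j => l' j end).
rewrite big_split_ord /=; congr (_ + _); apply: eq_bigr => i _.
  by rewrite (unsplitK (inl _ i)).
by rewrite (unsplitK (inr _ i)).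
Qed.

Lemma homog0 q : homog q (0 : polyfun W).
Proof.
apply/homogE; exists 0%N, (fun=> 0), (fun _ _ => 0); by rewrite big_ord0.
Qed.

Lemma homog_sum q (T : Type) (r : seq T) (P : pred T) (F : T -> polyfun W) :
  (forall i, P i -> homog q (F i)) -> homog q (\sum_(i <- r | P i) F i).
Proof. by move=> h; elim/big_ind: _ => //; [exact: homog0|exact: homogD]. Qed.

Lemma homog_monomial q (c : R) (l : 'I_q -> 'Hom(W, R^o)) :
  homog q (c *: \prod_(j < q) form_polyfun (l j)).
Proof.
by apply/homogE; exists 1%N, (fun=> c), (fun=> l); rewrite big_ord1.
Qed.

Lemma homogM q q' a b : homog q a -> homog q' b -> homog (q + q') (a * b).
Proof.
move=> /homogE[n [c [l ->]]] /homogE[n' [c' [l' ->]]].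
rewrite mulr_suml; apply: homog_sum => i _.
rewrite mulr_sumr; apply: homog_sum => i' _.
rewrite -scalerAl -scalerAr scalerA.
pose L j := match fintype.split j with inl k => l i k | inr k => l' i' k end.
rewrite (_ : _ * _ = \prod_(j < q + q') form_polyfun (L j)).
  exact: homog_monomial.
rewrite big_split_ord /=; congr (_ * _); apply: eq_bigr => j _.
  by rewrite /L (unsplitK (inl _ j)).
by rewrite /L (unsplitK (inr _ j)).
Qed.

Lemma homog_cst (c : R) : homog 0 (c%:A : polyfun W).
Proof.
have := @homog_monomial 0 c (fun=> 0); by rewrite big_ord0.
Qed.

Lemma homog_form l : homog 1 (form_polyfun l).
Proof. by have := @homog_monomial 1 1 (fun=> l); rewrite big_ord1 scale1r. Qed.

(** Peeling one linear form off each monomial reduces the action of $\mathfrak m$ to that of the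
    finite dimensional space of linear forms. *)
Lemma homogS_ind (P : polyfun W -> Prop) q :
  P 0 -> (forall a b, P a -> P b -> P (a + b)) ->
  (forall l b, homog q b -> P (form_polyfun l * b)) ->
  forall a, homog q.+1 a -> P a.
Proof.
move=> P0 PD PM a /homogE[n [c [l ->]]]; elim/big_ind: _ => // i _.
rewrite big_ord_recl scalerAr; apply: PM; exact: homog_monomial.
Qed.

Lemma homog_scale q a x (t : R) : homog q a -> a (t *: x) = t ^+ q * a x.
Proof.
move=> [n [c [l al]]]; rewrite !al mulr_sumr; apply: eq_bigr => i _.
rewrite mulrCA; congr (_ * _).
rewrite (eq_bigr (fun j => t * (l i j x : R))); last first.
  by move=> j _; rewrite linearZ.
by rewrite big_split /= prodr_const card_ord.
Qed.

Lemma polyfun_ind (P : polyfun W -> Prop) :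
  (forall a b, P a -> P b -> P (a + b)) ->
  (forall q a, homog q a -> P a) -> forall a, P a.
Proof.
move=> PD Ph.
suff H a : exists (n : nat) (q : 'I_n -> nat) (h : 'I_n -> polyfun W),
    (forall i, homog (q i) (h i)) /\ a = \sum_i h i.
  move=> a; have [n [q [h [hq ->]]]] := H a.
  elim/big_ind: _ => //; last by move=> i _; exact: Ph (hq i).
  exact: Ph (homog0 0).
case: a => f Pf.
have pf : Defs.polynomial f by exact: asboolW Pf.
elim: pf Pf => {f}.
- move=> c Pf; exists 1%N, (fun=> 0%N), (fun=> c%:A).
  split; first by move=> _; exact: homog_cst.
  by rewrite big_ord1; apply: polyfun_eq => x; rewrite polyfunA.
- move=> l Pf; exists 1%N, (fun=> 1%N), (fun=> form_polyfun l).
  split; first by move=> _; exact: homog_form.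
  by rewrite big_ord1; apply: polyfun_eq.
- move=> f g pf IHf pg IHg Pfg.
  have [n [q [h [hq ef]]]] := IHf (asboolT pf).
  have [n' [q' [h' [hq' eg]]]] := IHg (asboolT pg).
  exists (n + n')%N, (fun i => match fintype.split i with inl j => q j | inr j => q' j end).
  exists (fun i => match fintype.split i with inl j => h j | inr j => h' j end).
  split; first by move=> i; case: (fintype.split i).
  rewrite big_split_ord /=.
  rewrite (eq_bigr h); last by move=> i _; rewrite (unsplitK (inl _ i)).
  rewrite [X in _ + X](eq_bigr h'); last by move=> i _; rewrite (unsplitK (inr _ i)).
  by rewrite -ef -eg; apply: polyfun_eq.
- move=> f g pf IHf pg IHg Pfg.
  have [n [q [h [hq ef]]]] := IHf (asboolT pf).
  have [n' [q' [h' [hq' eg]]]] := IHg (asboolT pg).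
  exists #|{: 'I_n * 'I_n'}|, (fun i => (q (enum_val i).1 + q' (enum_val i).2)%N).
  exists (fun i => h (enum_val i).1 * h' (enum_val i).2).
  split; first by move=> i; exact: homogM.
  transitivity (\sum_(i : 'I_n * 'I_n') h i.1 * h' i.2); last first.
    by rewrite [LHS](reindex _ (onW_bij _ (enum_val_bij _))).
  rewrite -(pair_bigA _ (fun i j => h i * h' j)) /=.
  under eq_bigr do rewrite -mulr_sumr.
  by rewrite -mulr_suml -ef -eg; apply: polyfun_eq.
Qed.

(* the ideal m^N *)
Definition order_ge (N : nat) a : Prop :=
  exists (n : nat) (q : 'I_n -> nat) (h : 'I_n -> polyfun W),
    (forall i, (N <= q i)%N /\ homog (q i) (h i)) /\ a = \sum_i h i.

Lemma order_ge0 N : order_ge N 0.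
Proof. by exists 0%N, (fun=> N), (fun=> 0); rewrite big_ord0; split=> // -[]. Qed.

Lemma order_geD N a b : order_ge N a -> order_ge N b -> order_ge N (a + b).
Proof.
move=> [n [q [h [hq ->]]]] [n' [q' [h' [hq' ->]]]].
exists (n + n')%N, (fun i => match fintype.split i with inl j => q j | inr j => q' j end).
exists (fun i => match fintype.split i with inl j => h j | inr j => h' j end).
split; first by move=> i; case: (fintype.split i).
rewrite big_split_ord /=; congr (_ + _); apply: eq_bigr => i _.
  by rewrite (unsplitK (inl _ i)).
by rewrite (unsplitK (inr _ i)).
Qed.

Lemma order_ge_homog N q a : (N <= q)%N -> homog q a -> order_ge N a.
Proof.
by move=> Nq ha; exists 1%N, (fun=> q), (fun=> a); rewrite big_ord1; split.
Qed.

Lemma order_ge_ind (P : polyfun W -> Prop) N :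
  P 0 -> (forall a b, P a -> P b -> P (a + b)) ->
  (forall q a, (N <= q)%N -> homog q a -> P a) -> forall a, order_ge N a -> P a.
Proof.
move=> P0 PD Ph a [n [q [h [hq ->]]]]; elim/big_ind: _ => // i _.
by have [] := hq i; exact: Ph.
Qed.

Lemma max_idealE a : max_ideal a <-> order_ge 1 a.
Proof.
split.
  move=> [n [b [hb ->]]]; elim/big_ind: _ => //; first exact: order_ge0.
    exact: order_geD.
  by move=> i _; have [q q0] := hb i; exact: order_ge_homog.
by move=> [n [q [h [hq ->]]]]; exists n, h; split=> // i; have [? ?] := hq i; exists (q i).
Qed.

Lemma order_geM N N' a b : order_ge N a -> order_ge N' b -> order_ge (N + N') (a * b).
Proof.
move=> aN bN'; elim/order_ge_ind: a / aN => //.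
- by rewrite mul0r; exact: order_ge0.
- by move=> a a' ? ?; rewrite mulrDl; exact: order_geD.
move=> q a Nq ha; elim/order_ge_ind: b / bN' => //.
- by rewrite mulr0; exact: order_ge0.
- by move=> b b' ? ?; rewrite mulrDr; exact: order_geD.
move=> q' b Nq' hb; apply: (@order_ge_homog _ (q + q')); last exact: homogM.
exact: leq_add.
Qed.

Lemma order_ge_all a : order_ge 0 a.
Proof.
elim/polyfun_ind: a => [a b|q a]; first exact: order_geD.
exact: order_ge_homog.
Qed.

(** On a line through the origin, $t\mapsto a(tx)$ is a polynomial with two expansions: one of
    degree below [N], one divisible by $X^N$. They agree at every $t$, so both are zero. *)
Lemma order_ge_separated a : (forall N, order_ge N a) -> a = 0.
Proof.
move=> aN; have [n [q [h [hq ea]]]] := aN 0%N.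
pose N := (\max_i q i).+1.
have [n' [q' [g [gq eg]]]] := aN N.
apply: polyfun_eq => x /=.
pose P := \sum_(i < n) (h i x)%:P * 'X^(q i).
pose Q := \sum_(i < n') (g i x)%:P * 'X^(q' i).
have PQ t : P.[t] = Q.[t].
  have -> : P.[t] = a (t *: x).
    rewrite ea polyfun_sum horner_sum; apply: eq_bigr => i _.
    by rewrite !hornerE (homog_scale _ _ (proj2 (hq i))) mulrC.
  rewrite eg polyfun_sum horner_sum; apply: eq_bigr => i _.
  by rewrite !hornerE (homog_scale _ _ (proj2 (gq i))) mulrC.
have PQ0 : P - Q = 0.
  (* All natural numbers below the size of [P - Q] would be roots; they are distinct in [R], and
     there is one too many. *)
  apply: contrapT => /eqP nz.
  pose s : seq R := [seq i%:R | i <- iota 0 (size (P - Q))].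
  suff: (size s < size (P - Q)%R)%N by rewrite size_map size_iota ltnn.
  apply: max_poly_roots => //.
    by apply/allP => t _; rewrite rootE !hornerE PQ subrr.
  by rewrite map_inj_uniq ?iota_uniq //; apply: mulrIn; exact: oner_neq0.
have P0 : P = 0.
  apply/polyP => m; rewrite coef0.
  case: (leqP N m) => Nm.
    rewrite coef_sum big1 // => i _; rewrite coefCM coefXn.
    have -> : (m == q i) = false; last by rewrite mulr0.
    apply/negbTE; rewrite neq_ltn; apply/orP; right.
    by apply: leq_trans Nm; rewrite ltnS; apply: leq_bigmax.
  have -> : P = Q by apply/eqP; rewrite -subr_eq0 PQ0.
  rewrite coef_sum big1 // => i _; rewrite coefCM coefXn.
  have -> : (m == q' i) = false; last by rewrite mulr0.
  apply/negbTE; rewrite neq_ltn; apply/orP; left.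
  by apply: leq_trans Nm _; have [] := gq i.
have -> : a x = P.[1].
  rewrite ea polyfun_sum horner_sum; apply: eq_bigr => i _.
  by rewrite !hornerE expr1n mulr1.
by rewrite P0 horner0.
Qed.

Lemma homog_at0 q a : homog q a -> (0 < q)%N -> a 0 = 0.
Proof.
by case: q => // q ha _; rewrite -(scale0r (0 : W)) (homog_scale _ _ ha) expr0n mul0r.
Qed.

Lemma homog0E a : homog 0 a -> a = (a 0)%:A.
Proof.
move=> ha; apply: polyfun_eq => x; rewrite polyfunA.
by rewrite -(scale0r x) (homog_scale _ _ ha) expr0 mul1r.
Qed.

Lemma polyfun_sub_at0 a : max_ideal (a - (a 0)%:A).
Proof.
apply/max_idealE; elim/polyfun_ind: a => [a b ha hb|[|q] a ha].
- rewrite polyfunD scalerDl opprD addrACA; exact: order_geD.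
- by rewrite -(homog0E ha) subrr; exact: order_ge0.
- rewrite (homog_at0 ha) // scale0r subr0; exact: order_ge_homog ha.
Qed.

End Polynomials.

Lemma homog_pullback (R : realType) (U W : vectType R) (h : {linear U -> W}) q a :
  homog q a -> homog q (pullback h a).
Proof.
move=> [n [c [l al]]]; exists n, c, (fun i j => (l i j \o linfun h)%VF) => x /=.
rewrite al; apply: eq_bigr => i _; congr (_ * _); apply: eq_bigr => j _.
by rewrite comp_lfunE lfunE.
Qed.

(** * Free modules *)

Section TwistedLinear.
Variables (A B : pzRingType) (M : lmodType A) (N : lmodType B) (theta : A -> B).

(** Semilinearity over [theta]. Stalks over different cones are modules over different rings, so
    restrictions, evaluation of sections and the comparison maps are all of this kind. *)
Definition twisted_linear (f : M -> N) : Prop :=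
  (forall x y, f (x + y) = f x + f y) /\
  (forall a x, f (a *: x) = theta a *: f x).

Variable f : M -> N.
Hypothesis fl : twisted_linear f.

Lemma twistedD x y : f (x + y) = f x + f y. Proof. by case: fl. Qed.
Lemma twistedZ a x : f (a *: x) = theta a *: f x. Proof. by case: fl. Qed.
Lemma twisted0 : f 0 = 0.
Proof. by apply: (addrI (f 0)); rewrite -twistedD !addr0. Qed.
Lemma twistedN x : f (- x) = - f x.
Proof. by apply: (addrI (f x)); rewrite -twistedD !subrr twisted0. Qed.
Lemma twistedB x y : f (x - y) = f x - f y.
Proof. by rewrite twistedD twistedN. Qed.
Lemma twisted_sum (T : Type) (r : seq T) (P : pred T) (F : T -> M) :
  f (\sum_(i <- r | P i) F i) = \sum_(i <- r | P i) f (F i).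
Proof. exact: (big_morph f twistedD twisted0). Qed.

End TwistedLinear.

Section FreeModules.
Variables (A B : pzRingType) (M : lmodType A) (N : lmodType B).
Variable theta : {rmorphism A -> B}.

Let generates (E : set M) := forall x, exists (n : nat) (a : 'I_n -> A) (b : 'I_n -> M),
  (forall i, E (b i)) /\ x = \sum_i a i *: b i.
Let independent (E : set M) := forall (n : nat) (a : 'I_n -> A) (b : 'I_n -> M),
  injective b -> (forall i, E (b i)) -> \sum_i a i *: b i = 0 -> forall i, a i = 0.

(** Independence is stated for injective families only, while the [b i] may repeat; the coefficients
    of equal elements are collected before it applies. *)
Lemma free_extend_wd (E : set M) (F : M -> N) : independent E ->
  forall (n : nat) (a : 'I_n -> A) (b : 'I_n -> M), (forall i, E (b i)) ->
  \sum_i a i *: b i = 0 -> \sum_i theta (a i) *: F (b i) = 0.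
Proof.
move=> indE n a b Eb ab0.
pose s := undup [seq b i | i <- enum 'I_n].
have bs i : b i \in s by rewrite mem_undup map_f // mem_enum.
have qP i : (index (b i) s < size s)%N by rewrite index_mem.
pose q i := Ordinal (qP i).
pose b' (k : 'I_(size s)) := nth 0 s k.
have b'q i : b' (q i) = b i by rewrite /b' /= nth_index.
have part (U : nmodType) (G : 'I_n -> U) :
    \sum_i G i = \sum_(k < size s) \sum_(i | q i == k) G i.
  exact: (partition_big q xpredT).
have a'0 : forall k, \sum_(i | q i == k) a i = 0.
  apply: (indE _ _ b').
  - move=> k l /eqP; rewrite nth_uniq ?undup_uniq ?ltn_ord // => /eqP.
    exact: val_inj.
  - move=> k; have : b' k \in s by rewrite mem_nth.
    by rewrite mem_undup => /mapP[i _ ->].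
  - rewrite -[RHS]ab0 part; apply: eq_bigr => k _.
    by rewrite scaler_suml; apply: eq_bigr => i /eqP <-; rewrite b'q.
rewrite part big1 // => k _.
rewrite (eq_bigr (fun i => theta (a i) *: F (b' k))).
  by rewrite -scaler_suml -rmorph_sum a'0 rmorph0 scale0r.
by move=> i /eqP <-; rewrite b'q.
Qed.

Lemma free_extend (E : set M) (F : M -> N) : generates E -> independent E ->
  exists f, twisted_linear theta f /\ forall b, E b -> f b = F b.
Proof.
move=> genE indE.
(* The graph of the extension; it is single-valued by [free_extend_wd]. *)
pose G x y := exists (n : nat) (a : 'I_n -> A) (b : 'I_n -> M),
  [/\ forall i, E (b i), x = \sum_i a i *: b i & y = \sum_i theta (a i) *: F (b i)].
have G0 y : G 0 y -> y = 0.
  by move=> [n [a [b [Eb x0 ->]]]]; exact: (free_extend_wd F indE Eb (esym x0)).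
have GD c x y x' y' : G x y -> G x' y' -> G (c *: x + x') (theta c *: y + y').
  move=> [n [a [b [Eb -> ->]]]] [n' [a' [b' [Eb' -> ->]]]].
  exists (n + n')%N.
  exists (fun i => match fintype.split i with inl j => c * a j | inr j => a' j end).
  exists (fun i => match fintype.split i with inl j => b j | inr j => b' j end).
  split; first by move=> i; case: (fintype.split i).
    rewrite big_split_ord scaler_sumr /=; congr (_ + _); apply: eq_bigr => i _.
      by rewrite (unsplitK (inl _ i)) scalerA.
    by rewrite (unsplitK (inr _ i)).
  rewrite big_split_ord scaler_sumr /=; congr (_ + _); apply: eq_bigr => i _.
    by rewrite (unsplitK (inl _ i)) scalerA rmorphM.
  by rewrite (unsplitK (inr _ i)).
have Gfun x y y' : G x y -> G x y' -> y' = y.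
  move=> Gy Gy'; have := GD (-1) _ _ _ _ Gy Gy'.
  rewrite scaleN1r addNr rmorphN1 scaleN1r => /G0 /eqP.
  by rewrite addrC subr_eq0 => /eqP.
have Gex x : exists y, G x y.
  have [n [a [b [Eb ex]]]] := genE x.
  by exists (\sum_i theta (a i) *: F (b i)), n, a, b.
have [f fG] := choice Gex.
have fl c x x' : f (c *: x + x') = theta c *: f x + f x'.
  by apply: Gfun (fG _); apply: GD; exact: fG.
have f0 : f 0 = 0 by apply: G0.
exists f; split.
  split=> [x y|a x]; first by rewrite -[x in LHS]scale1r fl rmorph1 scale1r.
  by rewrite -[a *: x]addr0 fl f0 addr0.
move=> b Eb; apply: Gfun (fG b).
exists 1%N, (fun=> 1), (fun=> b); split=> //; rewrite big_ord1 ?rmorph1 scale1r //.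
Qed.

(** Choose [K]-related values on a basis and extend; linearity of the relation carries [K] from the
    basis to all elements. Here [K] will say that a value has the prescribed restrictions to the
    boundary. *)
Lemma free_lift (K : M -> N -> Prop) : free_module M -> K 0 0 ->
  (forall a x y x' y', K x y -> K x' y' -> K (a *: x + x') (theta a *: y + y')) ->
  (forall x, exists y, K x y) ->
  exists f, twisted_linear theta f /\ forall x, K x (f x).
Proof.
move=> [E [genE indE]] K0 KD Kex.
have [F FK] := choice Kex.
have [f [fl fF]] := free_extend F genE indE.
exists f; split=> // x.
have [n [a [b [Eb ->]]]] := genE x.
elim/big_rec: _ => [|i y _ Ky]; first by rewrite (twisted0 fl).
by rewrite (twistedD fl) (twistedZ fl) fF //; apply: KD.
Qed.

End FreeModules.

(** If all coordinate functionals vanish at [x], so does each collected coefficient in its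
    expansion. *)
Lemma free_functional (A : pzRingType) (M : lmodType A) (x : M) :
  free_module M -> x <> 0 ->
  exists f : M -> A^o, twisted_linear id f /\ f x <> 0.
Proof.
move=> [E [genE indE]] x0; apply: contrapT => nf; apply: x0.
have f0 f : twisted_linear (B := A) (N := A^o) id f -> f x = 0.
  by move=> fl; apply: contrapT => fx; apply: nf; exists f.
have [n [a [b [Eb ex]]]] := genE x.
(* the b i may repeat *)
pose s := undup [seq b i | i <- enum 'I_n].
rewrite ex.
have -> : \sum_i a i *: b i = \sum_(e <- s) (\sum_(i | b i == e) a i) *: e.
  under [RHS]eq_bigr do rewrite scaler_suml.
  rewrite (exchange_big_dep xpredT) //=; apply: eq_bigr => i _.
  rewrite (eq_bigl (pred1 (b i))) => [|e]; last exact: eq_sym.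
  rewrite -big_filter filter_pred1_uniq ?undup_uniq ?big_seq1 //.
  by rewrite mem_undup map_f // mem_enum.
rewrite big_seq big1 // => e es.
have Ee : E e by move: es; rewrite mem_undup => /mapP[i _ ->].
have [f [fl fF]] := @free_extend A A M A^o idfun E
  (fun e' => if e' == e then 1 else 0) genE indE.
have := f0 f fl; rewrite ex (twisted_sum fl).
rewrite (eq_bigr (fun i => if b i == e then a i else 0)).
  by rewrite -big_mkcond => ->; rewrite scale0r.
move=> i _; rewrite (twistedZ fl) fF //=.
by case: ifP => _; rewrite ?scaler0 // /GRing.scale /= mulr1.
Qed.

(** * Graded modules *)

Lemma big_seq_support (T : eqType) (M : nmodType) (s s' : seq T) (F : T -> M) :
  uniq s -> uniq s' -> (forall k, k \notin s -> F k = 0) ->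
  (forall k, k \notin s' -> F k = 0) -> \sum_(k <- s) F k = \sum_(k <- s') F k.
Proof.
move=> us us' s0 s0'.
have filt (r : seq T) : \sum_(k <- r) F k = \sum_(k <- [seq k <- r | F k != 0]) F k.
  rewrite big_filter [RHS]big_mkcond; apply: eq_bigr => k _.
  by case: eqP.
rewrite [LHS]filt [RHS]filt; apply: perm_big.
apply: uniq_perm; rewrite ?filter_uniq // => k; rewrite !mem_filter.
case: eqP => //= Fk.
have -> : k \in s by apply: contrapT => /negP /s0.
by have -> : k \in s' by apply: contrapT => /negP /s0'.
Qed.

Section Grading.
Variables (R : realType) (W : vectType R) (M : gmodule W).
Implicit Types (x y : M) (k l : int).
Let gr : int -> set M := @gmodule_deg R W M.
Let grP : is_grading gr := gmoduleP M.

Lemma gdeg0 k : gmodule_deg k (0 : M). Proof. exact: grading0 grP k. Qed.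
Lemma gdegB k x y : gmodule_deg k x -> gmodule_deg k y -> gmodule_deg k (x - y).
Proof. exact: (@gradingB _ _ _ _ grP). Qed.
Lemma gdegN k x : gmodule_deg k x -> gmodule_deg k (- x).
Proof. by rewrite -[- x]sub0r; apply: gdegB; exact: gdeg0. Qed.
Lemma gdegD k x y : gmodule_deg k x -> gmodule_deg k y -> gmodule_deg k (x + y).
Proof. by move=> hx hy; rewrite -[y]opprK; apply: gdegB => //; exact: gdegN. Qed.
Lemma gdegZ q k (a : polyfun W) x : homog q a -> gmodule_deg k x ->
  gmodule_deg (k + (2 * q)%:Z) (a *: x).
Proof. exact: (@gradingZ _ _ _ _ grP). Qed.
Lemma gdegZA k (c : R) x : gmodule_deg k x -> gmodule_deg k (c%:A *: x).
Proof. by move=> /(gdegZ (homog_cst W c)); rewrite addr0. Qed.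
Lemma gdeg_sum k (T : Type) (r : seq T) (P : pred T) (F : T -> M) :
  (forall i, P i -> gmodule_deg k (F i)) -> gmodule_deg k (\sum_(i <- r | P i) F i).
Proof. by move=> h; elim/big_ind: _ => //; [exact: gdeg0|exact: gdegD]. Qed.

Lemma gproj_exists x : exists c : int -> M, (forall k, gr k (c k)) /\
  exists s : seq int, [/\ uniq s, forall k, k \notin s -> c k = 0 & x = \sum_(k <- s) c k].
Proof.
have [s [c [hc ->]]] := grading_gen grP x.
(* [s] may list a degree several times, and each occurrence contributes a copy of [c k]. *)
exists (fun k => c k *+ count_mem k s); split.
  move=> k; elim: (count _ _) => [|n IHn]; first exact: gdeg0.
  by rewrite mulrS; exact: gdegD (hc k) IHn.
exists (undup s); split; first exact: undup_uniq.
  by move=> k; rewrite mem_undup => /count_memPn ->; rewrite mulr0n.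
rewrite -(big_undup_iterop_count +%R) /=.
by [].
Qed.

Definition gproj k x : M := projT1 (cid (gproj_exists x)) k.

Lemma gproj_deg k x : gmodule_deg k (gproj k x).
Proof. by rewrite /gproj; case: (cid _) => c [hc ?]; exact: hc. Qed.

Lemma gproj_supp x : exists s : seq int,
  [/\ uniq s, forall k, k \notin s -> gproj k x = 0 & x = \sum_(k <- s) gproj k x].
Proof. by rewrite /gproj; case: (cid (gproj_exists x)) => c /= [_ hc]. Qed.

Lemma gproj_unique x (c : int -> M) (s : seq int) : (forall k, gmodule_deg k (c k)) ->
  uniq s -> (forall k, k \notin s -> c k = 0) -> x = \sum_(k <- s) c k ->
  forall k, gproj k x = c k.
Proof.
move=> hc us cs ex; have [s' [us' cs' ex']] := gproj_supp x.
pose t := undup (s ++ s').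
have ut : uniq t by exact: undup_uniq.
have ts k : k \notin t -> k \notin s.
  by apply: contra; rewrite mem_undup mem_cat => ->.
have ts' k : k \notin t -> k \notin s'.
  by apply: contra; rewrite mem_undup mem_cat orbC => ->.
have ext : x = \sum_(k <- t) c k.
  by rewrite ex; apply: big_seq_support => // k /ts /cs.
have ext' : x = \sum_(k <- t) gproj k x.
  by rewrite {1}ex'; apply: big_seq_support => // k /ts' /cs'.
have e0 : \sum_(k <- t) (gproj k x - c k) = 0.
  by rewrite sumrB -ext -ext' subrr.
move=> k; case: (boolP (k \in t)) => kt; last by rewrite (cs' _ (ts' _ kt)) (cs _ (ts _ kt)).
apply/eqP; rewrite -subr_eq0; apply/eqP.
apply: (grading_free grP ut _ e0 kt) => l; apply: gdegB => //; exact: gproj_deg.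
Qed.

Lemma gproj_id k x : gmodule_deg k x -> gproj k x = x.
Proof.
move=> hx; rewrite (@gproj_unique x (fun l => if l == k then x else 0) [:: k]) ?eqxx //.
- by move=> l; case: eqP => [->//|_]; exact: gdeg0.
- by move=> l; rewrite inE => /negbTE ->.
- by rewrite big_seq1 eqxx.
Qed.

Lemma gproj_off k l x : gmodule_deg k x -> l != k -> gproj l x = 0.
Proof.
move=> hx lk.
rewrite (@gproj_unique x (fun l => if l == k then x else 0) [:: k]) ?(negbTE lk) //.
- by move=> m; case: eqP => [->//|_]; exact: gdeg0.
- by move=> m; rewrite inE => /negbTE ->.
- by rewrite big_seq1 eqxx.
Qed.

Lemma gprojD k x y : gproj k (x + y) = gproj k x + gproj k y.
Proof.
have [s [us cs ex]] := gproj_supp x; have [s' [us' cs' ey]] := gproj_supp y.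
pose t := undup (s ++ s').
have ut : uniq t by exact: undup_uniq.
have ts l : l \notin t -> l \notin s.
  by apply: contra; rewrite mem_undup mem_cat => ->.
have ts' l : l \notin t -> l \notin s'.
  by apply: contra; rewrite mem_undup mem_cat orbC => ->.
apply: (@gproj_unique _ (fun l => gproj l x + gproj l y) t) => //.
- by move=> l; apply: gdegD; exact: gproj_deg.
- by move=> l lt; rewrite (cs _ (ts _ lt)) (cs' _ (ts' _ lt)) addr0.
rewrite big_split {1}ex {1}ey; congr (_ + _); apply: big_seq_support => // l.
- by move=> /ts /cs.
- by move=> /ts' /cs'.
Qed.

Lemma gproj0 k : gproj k 0 = 0.
Proof. by apply: gproj_id; exact: gdeg0. Qed.
Lemma gprojN k x : gproj k (- x) = - gproj k x.
Proof. by apply: (addrI (gproj k x)); rewrite -gprojD !subrr gproj0. Qed.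
Lemma gprojB k x y : gproj k (x - y) = gproj k x - gproj k y.
Proof. by rewrite gprojD gprojN. Qed.
Lemma gmodule_ind (P : M -> Prop) :
  (forall x y, P x -> P y -> P (x + y)) ->
  (forall k x, gmodule_deg k x -> P x) -> forall x, P x.
Proof.
move=> PD Ph x; have [s [_ _ ->]] := gproj_supp x.
elim/big_ind: _ => //; first exact: (Ph 0) (gdeg0 0).
by move=> k _; apply: Ph (gproj_deg k x).
Qed.

Lemma gprojZ q k (a : polyfun W) x : homog q a ->
  gproj (k + (2 * q)%:Z) (a *: x) = a *: gproj k x.
Proof.
move=> ha; elim/gmodule_ind: x => [x y hx hy|l x hx].
  by rewrite scalerDr !gprojD hx hy scalerDr.
have hax := gdegZ ha hx.
case: (eqVneq l k) => [lk|lk]; first by rewrite -lk !gproj_id.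
rewrite (gproj_off hx) 1?eq_sym // scaler0 (gproj_off hax) //.
by rewrite (inj_eq (addIr _)) eq_sym.
Qed.

Lemma gproj_all0 x : (forall k, gproj k x = 0) -> x = 0.
Proof. by move=> h; have [s [_ _ ->]] := gproj_supp x; rewrite big1. Qed.

Lemma max_mul0 : max_mul (0 : M).
Proof. by exists 0%N, (fun=> 0), (fun=> 0); rewrite big_ord0; split=> // -[]. Qed.

Lemma max_mulD x y : max_mul x -> max_mul y -> max_mul (x + y).
Proof.
move=> [n [a [u [ha ->]]]] [n' [a' [u' [ha' ->]]]].
exists (n + n')%N.
exists (fun i => match fintype.split i with inl j => a j | inr j => a' j end).
exists (fun i => match fintype.split i with inl j => u j | inr j => u' j end).
split; first by move=> i; case: (fintype.split i).
rewrite big_split_ord /=; congr (_ + _); apply: eq_bigr => i _.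
  by rewrite (unsplitK (inl _ i)).
by rewrite (unsplitK (inr _ i)).
Qed.

Lemma max_mul_scale (a : polyfun W) x : max_ideal a -> max_mul (a *: x).
Proof. by move=> ha; exists 1%N, (fun=> a), (fun=> x); rewrite big_ord1. Qed.

Lemma max_mul_homog q (a : polyfun W) x : (0 < q)%N -> homog q a -> max_mul (a *: x).
Proof.
by move=> q0 ha; apply/max_mul_scale/max_idealE; apply: order_ge_homog ha.
Qed.

Lemma max_mul_ind (P : M -> Prop) : P 0 -> (forall x y, P x -> P y -> P (x + y)) ->
  (forall q a x, (0 < q)%N -> homog q a -> P (a *: x)) ->
  forall x, max_mul x -> P x.
Proof.
move=> P0 PD PZ _ [n [a [u [ha ->]]]]; elim/big_ind: _ => // i _.
have /max_idealE := ha i; elim/order_ge_ind: (a i) / => //.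
- by rewrite scale0r.
- by move=> b c hb hc; rewrite scalerDl; exact: PD.
- by move=> q b q0 hb; exact: PZ hb.
Qed.

(** Projecting an arbitrary expression for [x] to degree [k] makes every factor homogeneous, so the
    module elements involved have degree strictly below [k]. This drop is what the inductions on
    degree use. *)
Lemma max_mul_deg_ind k (P : M -> Prop) : P 0 -> (forall x y, P x -> P y -> P (x + y)) ->
  (forall q a x, (0 < q)%N -> homog q a -> gmodule_deg (k - (2 * q)%:Z) x -> P (a *: x)) ->
  forall x, gmodule_deg k x -> max_mul x -> P x.
Proof.
move=> P0 PD PZ x hx mx; rewrite -(gproj_id hx).
move: x mx {hx}; apply: max_mul_ind => [|x y hx hy|q a x q0 ha].
- by rewrite gproj0.
- by rewrite gprojD; exact: PD.
- rewrite -[k](subrK (2 * q)%:Z) (gprojZ _ _ ha); apply: PZ ha _ => //; exact: gproj_deg.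
Qed.

Lemma max_mul_proj k x : max_mul x -> max_mul (gproj k x).
Proof.
move=> mx; move: x mx; apply: max_mul_ind => [|x y hx hy|q a x q0 ha].
- by rewrite gproj0; exact: max_mul0.
- by rewrite gprojD; exact: max_mulD.
- by rewrite -[k](subrK (2 * q)%:Z) (gprojZ _ _ ha); exact: max_mul_homog ha.
Qed.

Lemma max_mulZ (a : polyfun W) x : max_mul x -> max_mul (a *: x).
Proof.
move=> [n [b [u [hb ->]]]]; rewrite scaler_sumr.
elim/big_ind: _ => [||i _]; [exact: max_mul0|exact: max_mulD|].
by rewrite scalerA mulrC -scalerA; exact: max_mul_scale.
Qed.

Lemma max_mulN x : max_mul x -> max_mul (- x).
Proof. by rewrite -scaleN1r; exact: max_mulZ. Qed.
Lemma max_mulB x y : max_mul x -> max_mul y -> max_mul (x - y).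
Proof. by move=> hx hy; apply: max_mulD => //; exact: max_mulN. Qed.
Lemma max_mul_sum (T : Type) (r : seq T) (P : pred T) (F : T -> M) :
  (forall i, P i -> max_mul (F i)) -> max_mul (\sum_(i <- r | P i) F i).
Proof. by move=> h; elim/big_ind: _ => //; [exact: max_mul0|exact: max_mulD]. Qed.

Lemma scale_at0 (a : polyfun W) x : max_mul (a *: x - (a 0)%:A *: x).
Proof. by rewrite -scalerBl; apply: max_mul_scale; exact: polyfun_sub_at0. Qed.

End Grading.

(** Freeness of a grading follows from projectors by applying them to a vanishing sum. Shifted
    powers and modules of sections inherit their projectors from the stalks. *)
Lemma is_grading_proj (R : realType) (W : vectType R) (M : lmodType (polyfun W))
    (gr : int -> set M) (pi : int -> M -> M) :
  (forall k, gr k 0) ->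
  (forall k x y, gr k x -> gr k y -> gr k (x - y)) ->
  (forall q k (a : polyfun W) x, homog q a -> gr k x -> gr (k + (2 * q)%:Z) (a *: x)) ->
  (forall k x y, pi k (x + y) = pi k x + pi k y) ->
  (forall k x, gr k (pi k x)) -> (forall k x, gr k x -> pi k x = x) ->
  (forall k l x, gr k x -> l != k -> pi l x = 0) ->
  (forall x, exists s : seq int, x = \sum_(k <- s) pi k x) -> is_grading gr.
Proof.
move=> h0 hB hZ piD pi_gr pi_id pi_off pi_gen; split=> //.
  by move=> x; have [s es] := pi_gen x; exists s, (pi^~ x).
move=> s c us hc e0 k ks.
have pi0 : pi k 0 = 0 by apply: pi_id.
have := congr1 (pi k) e0; rewrite pi0 (big_morph (pi k) (piD k) pi0).
rewrite (bigD1_seq k) //= pi_id // big1 ?addr0 // => l lk.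
by apply: pi_off (hc l) _; rewrite eq_sym.
Qed.

Section GradedMaps.
Variables (R : realType) (W W' : vectType R) (M : gmodule W) (N : gmodule W').
Variable theta : polyfun W -> polyfun W'.
Hypothesis theta_homog : forall q a, homog q a -> homog q (theta a).

Definition graded_map (d : int) (f : M -> N) : Prop :=
  forall k x, gmodule_deg k x -> gmodule_deg (k + d) (f x).

Lemma twisted_max_mul (f : M -> N) x : twisted_linear theta f -> max_mul x -> max_mul (f x).
Proof.
move=> fl mx; move: x mx; apply: max_mul_ind => [|x y hx hy|q a x q0 ha].
- by rewrite (twisted0 fl); exact: max_mul0.
- by rewrite (twistedD fl); exact: max_mulD.
- by rewrite (twistedZ fl); apply: max_mul_homog q0 _; exact: theta_homog.
Qed.

Lemma graded_map_proj d (f : M -> N) k x : twisted_linear theta f ->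
  graded_map d f -> gproj (k + d) (f x) = f (gproj k x).
Proof.
move=> fl fd; elim/gmodule_ind: x => [x y hx hy|l x hx].
  by rewrite (twistedD fl) !gprojD (twistedD fl) hx hy.
case: (eqVneq l k) => [lk|lk].
  by rewrite -lk !gproj_id //; exact: fd.
rewrite (gproj_off hx) 1?eq_sym // (twisted0 fl) (gproj_off (fd _ _ hx)) //.
by rewrite (inj_eq (addIr _)) eq_sym.
Qed.

End GradedMaps.

Section GradedPart.
Variables (R : realType) (W W' : vectType R) (M : gmodule W) (N : gmodule W').
Variable theta : {rmorphism polyfun W -> polyfun W'}.
Hypothesis theta_homog : forall q a, homog q a -> homog q (theta a).

(** The component of degree [d] of [f] sends $\sum_k x_k$ to $\sum_k f(x_k)_{k+d}$. It is still
    semilinear because [theta] preserves degrees. *)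
Lemma graded_part d (f : M -> N) : twisted_linear theta f ->
  exists g, [/\ twisted_linear theta g, graded_map d g &
    forall k x, gmodule_deg k x -> g x = gproj (k + d) (f x)].
Proof.
move=> fl.
have ex (x : M) : {s : seq int | [/\ uniq s, forall k : int, k \notin s -> gproj k x = 0 &
    x = \sum_(k <- s) gproj k x]} by apply: cid; exact: gproj_supp.
pose F (x : M) (k : int) := gproj (k + d) (f (gproj k x)).
pose g (x : M) := \sum_(k <- projT1 (ex x)) F x k.
have F0 x k : gproj k x = 0 -> F x k = 0.
  by rewrite /F => ->; rewrite (twisted0 fl) gproj0.
have gE x s : uniq s -> (forall k, k \notin s -> gproj k x = 0) -> g x = \sum_(k <- s) F x k.
  rewrite /g; case: (ex x) => t [ut t0 _] /= us s0.
  by apply: big_seq_support => // k; [move/t0/F0|move/s0/F0].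
have gh k x : gmodule_deg k x -> g x = gproj (k + d) (f x).
  move=> hx; rewrite (gE x [:: k]) // ?big_seq1 /F ?(gproj_id hx) // => l.
  by rewrite inE => lk; apply: gproj_off hx lk.
have gD x y : g (x + y) = g x + g y.
  rewrite [g x](gE x (undup (projT1 (ex x) ++ projT1 (ex y)))) ?undup_uniq //; last first.
    move=> k; case: (ex x) => s /= [_ s0 _] kt; apply: s0.
    by apply: contra kt; rewrite mem_undup mem_cat => ->.
  rewrite [g y](gE y (undup (projT1 (ex x) ++ projT1 (ex y)))) ?undup_uniq //; last first.
    move=> k; case: (ex y) => s /= [_ s0 _] kt; apply: s0.
    by apply: contra kt; rewrite mem_undup mem_cat orbC => ->.
  rewrite [g _](gE _ (undup (projT1 (ex x) ++ projT1 (ex y)))) ?undup_uniq //.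
    rewrite -big_split; apply: eq_bigr => k _.
    by rewrite /F gprojD (twistedD fl) gprojD.
  move=> k; case: (ex x) => s /= [_ s0 _]; case: (ex y) => s' /= [_ s0' _].
  rewrite mem_undup mem_cat negb_or => /andP[ks ks'].
  by rewrite gprojD s0 // s0' // addr0.
exists g; split=> //; last by move=> k x hx; rewrite (gh k) //; exact: gproj_deg.
split=> // a x; elim/polyfun_ind: a => [a b ha hb|q a ha].
  by rewrite scalerDl gD ha hb rmorphD scalerDl.
elim/gmodule_ind: x => [x y hx hy|k x hx].
  by rewrite scalerDr !gD hx hy scalerDr.
rewrite (gh _ _ (gdegZ ha hx)) (gh _ _ hx) (twistedZ fl) addrAC.
by rewrite (gprojZ _ _ (theta_homog ha)).
Qed.

(** An ungraded lift exists by freeness; stability of [K] under projection lets its component of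
    degree [d] replace it. *)
Lemma graded_free_lift d (K : M -> N -> Prop) : free_module M -> K 0 0 ->
  (forall a x y x' y', K x y -> K x' y' -> K (a *: x + x') (theta a *: y + y')) ->
  (forall k x y, gmodule_deg k x -> K x y -> K x (gproj (k + d) y)) ->
  (forall x, exists y, K x y) ->
  exists f, [/\ twisted_linear theta f, graded_map d f & forall x, K x (f x)].
Proof.
move=> freeM K0 KD Kproj Kex.
have [f [fl fK]] := free_lift freeM K0 KD Kex.
have [g [gl gd gh]] := graded_part d fl.
exists g; split=> // x; elim/gmodule_ind: x => [x y hx hy|k x hx].
  by have := KD 1 _ _ _ _ hx hy; rewrite (twistedD gl) rmorph1 !scale1r.
by rewrite (gh _ _ hx); apply: Kproj.
Qed.

End GradedPart.

(** * The graded Nakayama lemma and vanishing in negative degrees *)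

Section Nakayama.
Variables (R : realType) (W W' : vectType R).
Implicit Types (M : gmodule W).

Definition bounded_below M : Prop :=
  exists k0 : int, forall k (x : M), k < k0 -> gmodule_deg k x -> x = 0.

(** Induction on the degree above the lower bound: after subtracting the image of a homogeneous
    element, [y] becomes a combination of elements of smaller degree, which are images already. *)
Lemma graded_nakayama (M N : gmodule W) (f : M -> N) : bounded_below N ->
  twisted_linear id f -> graded_map 0 f ->
  (forall y, exists x, max_mul (y - f x)) -> forall y, exists x, y = f x.
Proof.
move=> [k0 Nk0] fl fd fbar.
suff H n : forall k (y : N), k < k0 + n%:Z -> gmodule_deg k y -> exists x, y = f x.
  move=> y; elim/gmodule_ind: y => [y y' [x ->] [x' ->]|k y hy].
    by exists (x + x'); rewrite (twistedD fl).
  by apply: (H `|k - k0|%N.+1 k) => //; lia.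
elim: n => [|n IHn] k y kn hy.
  by exists 0; rewrite (twisted0 fl); apply: Nk0 hy; lia.
have [x mx] := fbar y.
have /(max_mul_proj k) := mx; rewrite gprojB gproj_id //.
have := graded_map_proj k x (theta := idfun) fl fd; rewrite addr0 => ->.
set x' := gproj k x => mx'.
have hx' : gmodule_deg k (y - f x').
  by apply: gdegB => //; rewrite -[k]addr0; apply: fd; exact: gproj_deg.
suff [u eu] : exists u, y - f x' = f u.
  by exists (u + x'); rewrite (twistedD fl) -eu subrK.
move: (y - f x') hx' mx'; apply: max_mul_deg_ind.
- by exists 0; rewrite (twisted0 fl).
- by move=> _ _ [u ->] [v ->]; exists (u + v); rewrite (twistedD fl).
move=> q a z q0 ha hz; have [|v ->] := IHn _ _ _ hz; first by lia.
by exists (a *: v); rewrite (twistedZ fl).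
Qed.

(* x in M of degree < 0 lies in m^N M for every N; applying linear functionals
   M -> S(W^* ), which separate the points of a free module, shows x = 0 *)
Lemma free_bounded_below (M : gmodule W) : free_module M ->
  (forall k (x : M), k < 0 -> gmodule_deg k x -> max_mul x) ->
  forall k (x : M), k < 0 -> gmodule_deg k x -> x = 0.
Proof.
move=> freeM negM k x k0 hx; apply: contrapT => /(free_functional freeM)[f [fl]].
apply; apply: order_ge_separated => n.
elim: n k x k0 hx => [|n IHn] k x k0 hx; first exact: order_ge_all.
have mx := negM _ _ k0 hx.
move: x hx mx; apply: max_mul_deg_ind.
- by rewrite (twisted0 fl); exact: order_ge0.
- by move=> x y hx hy; rewrite (twistedD fl); exact: order_geD.
move=> q a x q0 ha hx; rewrite (twistedZ fl) -add1n; apply: order_geM.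
  exact: order_ge_homog ha.
by apply: IHn hx; lia.
Qed.

End Nakayama.

(** * Finite dimensional subspaces *)

Section FiniteDimension.
Variables (K : fieldType) (U : lmodType K).
Implicit Types (D N : U -> Prop).

Definition subspace D : Prop :=
  D 0 /\ forall (a : K) x y, D x -> D y -> D (a *: x + y).

Definition fin_dim D : Prop := exists (n : nat) (b : 'I_n -> U),
  (forall i, D (b i)) /\ forall x, D x -> exists c : 'I_n -> K, x = \sum_i c i *: b i.

Lemma subspaceD D x y : subspace D -> D x -> D y -> D (x + y).
Proof. by move=> [_ h] Dx Dy; rewrite -[x]scale1r; exact: h. Qed.
Lemma subspaceZ D a x : subspace D -> D x -> D (a *: x).
Proof. by move=> [D0 h] Dx; rewrite -[_ *: _]addr0; exact: h. Qed.
Lemma subspaceB D x y : subspace D -> D x -> D y -> D (x - y).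
Proof. by move=> [_ h] Dx Dy; rewrite addrC -scaleN1r; exact: h. Qed.
Lemma subspace_sum D (T : Type) (r : seq T) (P : pred T) (F : T -> U) :
  subspace D -> (forall i, P i -> D (F i)) -> D (\sum_(i <- r | P i) F i).
Proof.
move=> sD h; elim/big_ind: _ => //; first by case: sD.
by move=> x y; exact: subspaceD.
Qed.

(** A finite dimensional kernel and an image inside a finitely generated space suffice. The family
    [b] need be neither independent nor contained in the image. *)
Lemma fin_dim_extension (U' : lmodType K) (f : U -> U') n (b : 'I_n -> U') D :
  (forall a x y, f (a *: x + y) = a *: f x + f y) -> subspace D ->
  (forall x, D x -> exists c : 'I_n -> K, f x = \sum_i c i *: b i) ->
  fin_dim (fun x => D x /\ f x = 0) -> fin_dim D.
Proof.
move=> fl; elim: n b D => [|n IHn] b D sD fb fker.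
  have D0 x : D x -> f x = 0 by move=> /fb[c ->]; rewrite big_ord0.
  have [m [e [De es]]] := fker; exists m, e; split; first by move=> i; case: (De i).
  by move=> x Dx; apply: es; split=> //; exact: D0.
(* Vectors whose image can be written without [b ord0]. Either [D] equals [D'], or one vector [x0]
   with nonzero leading coefficient generates [D] together with [D']. *)
pose D' x := D x /\ exists c : 'I_n -> K, f x = \sum_i c i *: b (lift ord0 i).
have sD' : subspace D'.
  have f0 : f 0 = 0 by rewrite -[0 in LHS](subrr 0) addrC -scaleN1r fl scaleN1r addNr.
  split; first split; first by case: sD.
    by exists (fun=> 0); rewrite f0 big1 // => i _; rewrite scale0r.
  move=> a x y [Dx [c ex]] [Dy [c' ey]]; split; first by case: sD => _; exact.
  exists (fun i => a * c i + c' i); rewrite fl ex ey scaler_sumr -big_split.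
  by apply: eq_bigr => i _; rewrite scalerDl scalerA.
have fD' : fin_dim D'.
  apply: (IHn (fun i => b (lift ord0 i))) => //; first by move=> x [].
  have [m [e [De es]]] := fker; exists m, e; split.
    move=> i; have [Dei fei] := De i; split=> //; split=> //.
    by exists (fun=> 0); rewrite fei big1 // => j _; rewrite scale0r.
  by move=> x [[Dx _] fx]; apply: es.
have [m [e [De es]]] := fD'.
case: (pselect (exists x c, [/\ D x, f x = \sum_i c i *: b i & c ord0 != 0])).
  move=> [x0 [c0 [Dx0 ex0 c00]]].
  exists m.+1, (fun i => if unlift ord0 i is Some j then e j else x0); split.
    by move=> i; case: (unlift _ _) => // j; case: (De j).
  move=> x Dx; have [c ex] := fb x Dx.
  pose t := c ord0 / c0 ord0.
  have [|v ev] := es (x - t *: x0).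
    split; first by apply: subspaceB => //; exact: subspaceZ.
    exists (fun i => c (lift ord0 i) - t * c0 (lift ord0 i)).
    rewrite addrC -scaleNr fl scaleNr addrC ex ex0 !big_ord_recl scalerDr scalerA.
    rewrite divfK // opprD addrACA subrr add0r scaler_sumr -sumrB.
    by apply: eq_bigr => i _; rewrite scalerBl scalerA.
  exists (fun i => if unlift ord0 i is Some j then v j else t).
  rewrite big_ord_recl unlift_none; under eq_bigr do rewrite liftK.
  by rewrite -ev addrC subrK.
move=> no; exists m, e; split; first by move=> i; case: (De i).
move=> x Dx; apply: es; split=> //; have [c ex] := fb x Dx.
exists (fun i => c (lift ord0 i)); rewrite ex big_ord_recl.
case: (eqVneq (c ord0) 0) => [->|c0]; first by rewrite scale0r add0r.
by case: no; exists x, c.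
Qed.

(** The spanning family may lie outside [D]; the identity map in [fin_dim_extension] turns it into
    one inside [D]. *)
Lemma fin_dim_span (T : finType) (b : T -> U) D : subspace D ->
  (forall x, D x -> exists c : T -> K, x = \sum_i c i *: b i) -> fin_dim D.
Proof.
move=> sD Db; apply: (@fin_dim_extension _ idfun #|T| (fun i => b (enum_val i))) => //.
  move=> x /Db[c ->]; exists (fun i => c (enum_val i)).
  by rewrite [LHS](reindex _ (onW_bij _ (enum_val_bij _))).
exists 0%N, (fun=> 0); split=> [[]//|x [_ /= ->]].
by exists (fun=> 0); rewrite big_ord0.
Qed.

Lemma fin_dimS D N : subspace N -> (forall x, N x -> D x) -> fin_dim D -> fin_dim N.
Proof.
move=> sN ND [n [b [_ Db]]]; apply: (fin_dim_span (b := b) sN) => x /ND; exact: Db.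
Qed.

Definition independent_mod N (T : finType) (b : T -> U) : Prop :=
  forall c : T -> K, N (\sum_i c i *: b i) -> forall i, c i = 0.

Lemma basis_mod D N : subspace D -> subspace N -> fin_dim D ->
  exists (n : nat) (b : 'I_n -> U), [/\ forall i, D (b i), independent_mod N b &
    forall x, D x -> exists c : 'I_n -> K, N (x - \sum_i c i *: b i)].
Proof.
move=> sD sN [n0 [b0 [Db0 sp0]]].
pose P n := `[< exists b : 'I_n -> U, (forall i, D (b i)) /\
    forall x, D x -> exists c : 'I_n -> K, N (x - \sum_i c i *: b i) >].
have exP : exists n, P n.
  exists n0; apply/asboolP; exists b0; split=> // x /sp0[c ->]; exists c.
  by rewrite subrr; case: sN.
have [n /asboolP[b [Db sp]] minn] := ex_minnP exP.
exists n, b; split=> // c Nc i0; apply: contrapT => /eqP ci0.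
case: n b Db sp minn c Nc i0 ci0 => [|n] b Db sp minn c Nc i0 ci0; first by case: i0 ci0.
suff /minn : P n by rewrite ltnn.
apply/asboolP; exists (fun j => b (lift i0 j)); split=> // x /sp[c' Nc'].
pose t := c' i0 / c i0.
exists (fun j => c' (lift i0 j) - t * c (lift i0 j)).
have := subspaceD sN Nc' (subspaceZ t sN Nc).
rewrite !(bigD1_ord i0) //= opprD scalerDr scalerA divfK //.
set y := \sum_i _; set z := \sum_i _.
have -> : x + (- (c' i0 *: b i0) - y) + (c' i0 *: b i0 + t *: z) = x - (y - t *: z).
  by rewrite opprB -addrA; congr (x + _); rewrite addrACA addNr add0r addrC.
rewrite scaler_sumr -sumrB; congr (N (x - _)); apply: eq_bigr => j _.
by rewrite scalerBl scalerA.
Qed.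

(** If [T] had more than [d] elements, the matrix of coefficients would have a nonzero vector in its
    left kernel, that is, a relation among the [u t] modulo [N]. *)
Lemma independent_mod_leq N (T : finType) (u : T -> U) d (b : 'I_d -> U) :
  subspace N -> independent_mod N u ->
  (forall t, exists c : 'I_d -> K, N (u t - \sum_i c i *: b i)) -> (#|T| <= d)%N.
Proof.
move=> sN indu spb; rewrite leqNgt; apply/negP => dT.
have [X NX] := choice spb.
pose A := \matrix_(i < #|T|, j < d) X (enum_val i) j.
have : kermx A != 0.
  rewrite kermx_eq0 /row_free neq_ltn; apply/orP; left.
  exact: leq_ltn_trans (rank_leq_col A) dT.
move=> /rowV0Pn[v /sub_kermxP vA /eqP]; apply; apply/rowP => i; rewrite mxE.
pose c t := v ord0 (enum_rank t).
suff : N (\sum_t c t *: u t) by move=> /indu/(_ (enum_val i)); rewrite /c enum_valK.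
have -> : \sum_t c t *: u t = \sum_t c t *: (u t - \sum_j X t j *: b j).
  under [RHS]eq_bigr do rewrite scalerBr.
  rewrite sumrB -[LHS]subr0; congr (_ - _); apply/esym.
  under eq_bigr do rewrite scaler_sumr.
  rewrite exchange_big big1 //= => j _.
  under eq_bigr do rewrite scalerA.
  rewrite -scaler_suml; apply/eqP; rewrite scaler_eq0; apply/orP; left; apply/eqP.
  have /rowP/(_ j) := vA; rewrite !mxE => vAj; apply: etrans vAj.
  rewrite [LHS](reindex _ (onW_bij _ (enum_val_bij _))).
  by apply: eq_bigr => k _; rewrite !mxE /c enum_valK.
by apply: subspace_sum => // t _; exact: subspaceZ.
Qed.

(** In a basis, surjectivity gives a one-sided inverse of a square matrix, which is then
    two-sided. *)
Lemma surjective_injective D (f : U -> U) :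
  (forall a x y, f (a *: x + y) = a *: f x + f y) -> subspace D -> fin_dim D ->
  (forall x, D x -> D (f x)) -> (forall y, D y -> exists2 x, D x & y = f x) ->
  forall x, D x -> f x = 0 -> x = 0.
Proof.
move=> fl sD fD fDD fsurj.
have sK : subspace (fun x => x = 0).
  by split=> // a x y -> ->; rewrite scaler0 addr0.
have [n [b [Db indb spb]]] := basis_mod sD sK fD.
have {}spb x : D x -> exists c : 'I_n -> K, x = \sum_i c i *: b i.
  by move=> /spb[c /subr0_eq ?]; exists c.
have f0 : f 0 = 0 by rewrite -[0 in LHS](subrr 0) addrC -scaleN1r fl scaleN1r addNr.
have f_sum (v : 'I_n -> K) : f (\sum_i v i *: b i) = \sum_i v i *: f (b i).
  elim/big_rec2: _ => // i y z _ <-; exact: fl.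
have exX i : exists c : 'I_n -> K, f (\sum_j c j *: b j) = b i.
  by have [x Dx ->] := fsurj _ (Db i); have [c ->] := spb _ Dx; exists c.
have [X fX] := choice exX.
have exF i : exists c : 'I_n -> K, f (b i) = \sum_j c j *: b j.
  by have [c ?] := spb _ (fDD _ (Db i)); exists c.
have [F fF] := choice exF.
have f_sumF (v : 'I_n -> K) : f (\sum_i v i *: b i) = \sum_j (\sum_i v i * F i j) *: b j.
  rewrite f_sum; under eq_bigr do rewrite fF scaler_sumr.
  rewrite exchange_big; apply: eq_bigr => j _ /=.
  by rewrite scaler_suml; apply: eq_bigr => i _; rewrite scalerA.
pose MX := \matrix_(i, j) X i j; pose MF := \matrix_(i, j) F i j.
have XF : MX *m MF = 1%:M.
  apply/matrixP => i k; rewrite !mxE.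
  apply/eqP; rewrite -subr_eq0; apply/eqP; move: k; apply: indb.
  under eq_bigr do rewrite scalerBl.
  rewrite sumrB; apply/eqP; rewrite subr_eq0; apply/eqP.
  transitivity (b i).
    rewrite -[RHS]fX f_sumF; apply: eq_bigr => j _; congr (_ *: _).
    by apply: eq_bigr => l _; rewrite !mxE.
  rewrite (bigD1 i) //= eqxx scale1r big1 ?addr0 // => j ji.
  by rewrite eq_sym (negbTE ji) scale0r.
have FX := mulmx1C XF.
move=> x /spb[v ->]; rewrite f_sumF => /indb v0.
pose r : 'rV_n := \row_i v i.
have rF : r *m MF = 0.
  apply/rowP => j; rewrite !mxE -[RHS](v0 j); apply: eq_bigr => i _; by rewrite !mxE.
have r0 : r = 0 by rewrite -[r]mulmx1 -FX mulmxA rF mul0mx.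
rewrite big1 // => i _; have := congr1 (fun A : 'rV_n => A ord0 i) r0.
by rewrite !mxE => ->; rewrite scale0r.
Qed.

End FiniteDimension.

(** A copy of [M] that carries the action of the real constants, so that it does not compete with
    the module structure over the polynomial ring. *)
Definition real_module (R : realType) (W : vectType R) (M : lmodType (polyfun W)) : Type := M.

Section RealModule.
Variables (R : realType) (W : vectType R) (M : lmodType (polyfun W)).
HB.instance Definition _ := GRing.Zmodule.on (real_module M).

Definition real_scale (c : R) (x : real_module M) : real_module M := c%:A *: (x : M).

Lemma real_scaleA a b x : real_scale a (real_scale b x) = real_scale (a * b) x.
Proof. by rewrite /real_scale scalerA -scalerAl mul1r scalerA. Qed.
Lemma real_scale1 : left_id 1 real_scale.
Proof. by move=> x; rewrite /real_scale !scale1r. Qed.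
Lemma real_scaleDr : right_distributive real_scale +%R.
Proof. by move=> a x y; exact: scalerDr. Qed.
Lemma real_scaleDl x : {morph real_scale^~ x : a b / a + b}.
Proof. by move=> a b; rewrite /real_scale !scalerDl. Qed.
HB.instance Definition _ := GRing.Zmodule_isLmodule.Build R (real_module M)
  real_scaleA real_scale1 real_scaleDr real_scaleDl.
End RealModule.

Section FiniteDegrees.
Variables (R : realType) (W : vectType R).

Definition fin_deg (M : gmodule W) (k : int) : Prop :=
  @fin_dim R (real_module M) (@gmodule_deg R W M k).

Lemma subspace_deg (M : gmodule W) k : @subspace R (real_module M) (@gmodule_deg R W M k).
Proof.
split; first exact: gdeg0.
by move=> a x y hx hy; apply: gdegD => //; exact: gdegZA.
Qed.

Lemma subspace_max_mul (M : gmodule W) : @subspace R (real_module M) (@max_mul R W M).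
Proof.
split; first exact: max_mul0.
by move=> a x y hx hy; apply: max_mulD => //; exact: max_mulZ.
Qed.

Lemma fin_deg_bar_basis (M : gmodule W) k : fin_deg M k ->
  exists d (b : 'I_d -> M), bar_basis (@gmodule_deg R W M k) b.
Proof.
move=> /(basis_mod (subspace_deg M k) (subspace_max_mul M))[d [b [Db indb spb]]].
by exists d, b; split.
Qed.

Lemma bar_dimP (M : gmodule W) k : fin_deg M k ->
  exists b : 'I_(bar_dim (@gmodule_deg R W M k)) -> M, bar_basis (@gmodule_deg R W M k) b.
Proof.
move=> /fin_deg_bar_basis[d hd].
exact: (@xgetPex _ 0%N [set d | exists b : 'I_d -> M, bar_basis _ b] (ex_intro _ d hd)).
Qed.

(** Finiteness in degree [k] ensures that [bar_dim] is a true dimension and not its default value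
    0. *)
Lemma leq_bar_dim (M : gmodule W) k (T : finType) (u : T -> M) : fin_deg M k ->
  (forall t, gmodule_deg k (u t)) ->
  (forall c : T -> R, max_mul (\sum_t (c t)%:A *: u t) -> forall t, c t = 0) ->
  (#|T| <= bar_dim (@gmodule_deg R W M k))%N.
Proof.
move=> /bar_dimP[b [_ _ spb]] hu indu.
apply: (@independent_mod_leq R (real_module M) (@max_mul R W M) T u _ b) => //.
  exact: subspace_max_mul.
by move=> t; exact: spb.
Qed.

(** A homogeneous element of positive degree is a sum of products $l\,b$ with $l$ a linear form, and
    $bx$ then has degree $k-2$. So products of a basis of linear forms with generators in degree
    $k-2$ span. *)
Lemma fin_dim_max_mul (M : gmodule W) k : (forall l, l < k -> fin_deg M l) ->
  @fin_dim R (real_module M) (fun x => gmodule_deg k x /\ max_mul x).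
Proof.
move=> fM; have [|n [b [_ spb]]] := fM (k - 2); first by lia.
pose e (i : 'I_(\dim {:'Hom(W, R^o)})) := form_polyfun (vbasis {:'Hom(W, R^o)})`_i.
apply: (@fin_dim_span R (real_module M) _
  (fun t : 'I_(\dim {:'Hom(W, R^o)}) * 'I_n => (e t.1 *: b t.2 : M))).
  have [sD sD'] := subspace_deg M k; have [sN sN'] := subspace_max_mul M.
  by split=> // a x y [? ?] [? ?]; split; [exact: sD'|exact: sN'].
move=> x [hx mx]; move: x hx mx; apply: max_mul_deg_ind.
- by exists (fun=> 0); rewrite big1 // => t _; rewrite scale0r.
- move=> x y [c ->] [c' ->]; exists (fun t => c t + c' t).
  by rewrite -big_split; apply: eq_bigr => t _; rewrite scalerDl.
move=> [//|q] a x _ ha hx.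
move: a ha; apply: homogS_ind.
- by exists (fun=> 0); rewrite scale0r big1 // => t _; rewrite scale0r.
- move=> a a' [c ea] [c' ea']; exists (fun t => c t + c' t).
  rewrite scalerDl ea ea' -big_split; apply: eq_bigr => t _.
  by rewrite [RHS]scalerDl.
move=> l a ha.
have [|c ec] := spb (a *: x).
  by have := gdegZ ha hx; congr (gmodule_deg _ _); lia.
pose v i := coord (vbasis {:'Hom(W, R^o)}) i l.
exists (fun t => v t.1 * c t.2).
have -> : form_polyfun l = \sum_i v i *: e i.
  apply: polyfun_eq => w; rewrite polyfun_sum /= {1}(coord_vbasis (memvf l)) sum_lfunE.
  by apply: eq_bigr => i _; rewrite scale_lfunE.
rewrite -scalerA ec scaler_suml.
transitivity (\sum_i \sum_j (v i * c j) *: (e i *: b j : real_module M)); last first.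
  exact: pair_bigA.
apply: eq_bigr => i _; rewrite scaler_sumr; apply: eq_bigr => j _.
change ((v i *: e i) *: ((c j)%:A *: (b j : M)) = (v i * c j)%:A *: (e i *: (b j : M))).
rewrite !scalerA; congr (_ *: _); apply: polyfun_eq => w.
by rewrite !polyfunM !polyfunA polyfunZ mulrAC.
Qed.

Lemma graded_surjective_injective (M : gmodule W) (f : M -> M) :
  (forall k, fin_deg M k) -> twisted_linear id f -> graded_map 0 f ->
  (forall y, exists x, y = f x) -> forall x, f x = 0 -> x = 0.
Proof.
move=> fM fl fd fs x fx; apply: gproj_all0 => k.
have fproj y : gproj k (f y) = f (gproj k y).
  by have := graded_map_proj k y (theta := idfun) fl fd; rewrite addr0.
apply: (@surjective_injective R (real_module M) _ f _ (subspace_deg M k) (fM k)).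
- by move=> a y z; rewrite (twistedD fl) (twistedZ fl).
- by move=> y hy; rewrite -[k]addr0; exact: fd.
- move=> y hy; have [z ey] := fs y; exists (gproj k z); first exact: gproj_deg.
  by rewrite -fproj -ey gproj_id.
- exact: gproj_deg.
- by rewrite -fproj fx gproj0.
Qed.

End FiniteDegrees.

Section ShiftedPower.
Variables (R : realType) (W : vectType R) (M : gmodule W) (J : finType) (d : J -> int).
Let P : lmodType (polyfun W) := {ffun J -> M}.

(** The direct sum of the shifts $M(-d_j)$; with this grading a matrix whose entry at $(j,j')$ has
    degree $d_{j'}-d_j$ becomes a map of degree 0. *)
Definition power_deg (k : int) : set P := [set h | forall j, gmodule_deg (k - d j) (h j)].

Lemma power_grading : is_grading power_deg.
Proof.
apply: (@is_grading_proj _ _ _ _ (fun k (h : P) => [ffun j => gproj (k - d j) (h j)] : P)).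
- by move=> k j; rewrite ffunE; exact: gdeg0.
- by move=> k x y hx hy j; rewrite !ffunE; exact: gdegB.
- by move=> q k a x ha hx j; rewrite !ffunE addrAC; exact: gdegZ.
- by move=> k x y; apply/ffunP => j; rewrite !ffunE gprojD.
- by move=> k x j; rewrite ffunE; exact: gproj_deg.
- by move=> k x hx; apply/ffunP => j; rewrite ffunE gproj_id.
- move=> k l x hx lk; apply/ffunP => j; rewrite !ffunE (gproj_off (hx j)) //.
  by rewrite (inj_eq (addIr _)).
move=> x.
have [s hs] := choice (fun j => gproj_supp (x j)).
pose t := undup [seq k + d j | j <- enum J, k <- s j].
exists t; apply/ffunP => j; rewrite sum_ffunE.
have [us s0 {1}->] := hs j.
rewrite [RHS](eq_bigr (fun k => gproj (k - d j) (x j))); last by move=> k _; rewrite ffunE.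
transitivity (\sum_(k <- [seq k + d j | k <- s j]) gproj (k - d j) (x j)).
  by rewrite big_map; apply: eq_bigr => k _; rewrite addrK.
apply: big_seq_support.
- by rewrite map_inj_uniq //; exact: addIr.
- exact: undup_uniq.
- move=> k; apply: contraNeq => nz; apply/mapP; exists (k - d j); last by rewrite subrK.
  by apply: contraNT nz => /s0 ->.
- move=> k; apply: contraNeq => nz; rewrite mem_undup; apply/allpairsPdep.
  exists j, (k - d j); split; [by rewrite mem_enum| |by rewrite subrK].
  by apply: contraNT nz => /s0 ->.
Qed.

Definition power_gmodule : gmodule W := GModule power_grading.

Lemma power_bounded (k0 : int) : (forall k (x : M), k < k0 -> gmodule_deg k x -> x = 0) ->
  (forall j, 0 <= d j) -> bounded_below power_gmodule.
Proof.
move=> Mk0 d0; exists k0 => k x kk0 hx; apply/ffunP => j; rewrite ffunE.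
by apply: Mk0 (hx j); have := d0 j; lia.
Qed.

Lemma power_fin_deg : (forall k, fin_deg M k) -> forall k, fin_deg power_gmodule k.
Proof.
move=> fM k.
have ex j : exists nb : {n : nat & 'I_n -> M}, forall x, gmodule_deg (k - d j) x ->
    exists c : 'I_(tag nb) -> R, x = \sum_i (c i)%:A *: tagged nb i.
  by have [n [b [_ sp]]] := fM (k - d j); exists (Tagged (fun n => 'I_n -> M) b).
have [B spB] := choice ex.
pose e (t : {j : J & 'I_(tag (B j))}) : P :=
  [ffun j => if j == tag t then tagged (B (tag t)) (tagged t) else 0].
apply: (@fin_dim_span R (real_module power_gmodule) _ e).
  exact: (subspace_deg power_gmodule).
move=> x hx; pose C j := cid (spB j _ (hx j)).
pose c j : 'I_(tag (B j)) -> R := projT1 (C j).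
have hc j : (x : P) j = \sum_i (c j i)%:A *: tagged (B j) i := projT2 (C j).
exists (fun t => c (tag t) (tagged t)).
apply/ffunP => j; rewrite (hc j) sum_ffunE.
pose F j' (i : 'I_(tag (B j'))) : M :=
  (c j' i)%:A *: (if j == j' then tagged (B j') i else 0).
transitivity (\sum_j' \sum_i F j' i); last first.
  rewrite sig_big_dep; apply: eq_bigr => -[j' i] _.
  by rewrite /= /F !ffunE.
rewrite (bigD1 j) //= [X in _ + X]big1 ?addr0.
  by apply: eq_bigr => i _; rewrite /F eqxx.
move=> j' jj'; rewrite big1 // => i _.
by rewrite /F eq_sym (negbTE jj') scaler0.
Qed.

End ShiftedPower.

(** * Stalks of a minimal extension sheaf *)

Lemma face_refl (R : realType) (V : vectType R) (sigma : set V) : face sigma sigma.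
Proof.
exists 0; first by move=> v _; rewrite /halfspace /= lfunE.
by apply/seteqP; split=> [v sv|v []//]; split=> //=; rewrite memv_ker lfunE.
Qed.

Lemma face_subset (R : realType) (V : vectType R) (sigma tau : set V) :
  face tau sigma -> tau `<=` sigma.
Proof. by move=> [beta _ ->] v []. Qed.

(** If the spans agreed, the form cutting out [tau] would vanish on all of [sigma]. The dimension of
    the span thus serves as rank for inductions over cones. *)
Lemma face_dim (R : realType) (V : vectType R) (sigma tau : set V) :
  face tau sigma -> tau <> sigma -> (\dim (cone_span tau) < \dim (cone_span sigma))%N.
Proof.
move=> ts nts; have sub := cone_spanS (face_subset ts).
rewrite (ltn_leqif (dimv_leqif_sup sub)); apply/negP => sub'; apply: nts.
apply/seteqP; split; first exact: face_subset.
have [beta _ tE] := ts; move=> v sv; rewrite tE; split=> //=.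
have /(subvP sub') : v \in cone_span sigma by apply/mem_cone_span => U; apply.
by move/mem_cone_span; apply; rewrite tE => w [].
Qed.

Lemma pullbackA (R : realType) (U W : vectType R) (h : {linear U -> W}) (c : R) :
  pullback h c%:A = c%:A.
Proof. by apply: polyfun_eq => x; rewrite /= !mulr1. Qed.

(** A change of ring does no harm: [bar_basis] depends only on the real scalars and on the submodule
    [max_mul], and both are preserved. *)
Lemma bar_basis_transfer (R : realType) (W W' : vectType R) (M : lmodType (polyfun W))
    (N : lmodType (polyfun W')) (D : set M) (D' : set N) (f : M -> N) (g : N -> M)
    (theta : polyfun W -> polyfun W') :
  twisted_linear theta f -> (forall x, max_mul x -> max_mul (f x)) ->
  (forall x, max_mul x -> max_mul (g x)) ->
  (forall c : R, theta c%:A = c%:A) ->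
  cancel f g -> cancel g f -> (forall x, D x -> D' (f x)) -> (forall y, D' y -> D (g y)) ->
  forall d (b : 'I_d -> M), bar_basis D b -> bar_basis D' (f \o b).
Proof.
move=> fl fm gm tA fK gK fD gD d b [Db indb spb].
have f_sum (c : 'I_d -> R) : f (\sum_i (c i)%:A *: b i) = \sum_i (c i)%:A *: f (b i).
  by rewrite (twisted_sum fl); apply: eq_bigr => i _; rewrite (twistedZ fl) tA.
split=> [i|c mc|y D'y]; first exact: fD.
  by apply: indb; move: mc; rewrite -f_sum => /gm; rewrite fK.
have [c /fm mc] := spb _ (gD _ D'y); exists c.
by move: mc; rewrite (twistedB fl) gK f_sum.
Qed.

#[local] Obligation Tactic := idtac.

Section Stalks.
Variables (R : realType) (V : vectType R) (Delta : set (set V)) (E : gsheaf Delta).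
Implicit Types (gamma : Delta) (Lambda : set Delta) (k : int).

Definition proper_face gamma' gamma : Prop :=
  face (val gamma') (val gamma) /\ gamma' <> gamma.

Lemma proper_face_dim gamma' gamma : proper_face gamma' gamma ->
  (\dim (cone_span (val gamma')) < \dim (cone_span (val gamma)))%N.
Proof. by move=> [f ne]; apply: face_dim f _ => /val_inj. Qed.

Lemma res_twisted gamma gamma' : face (val gamma') (val gamma) ->
  twisted_linear (@to_face R V (val gamma) (val gamma')) (sheaf_res E gamma gamma').
Proof. by move=> f; split=> [x y|a x]; [exact: raddfD|exact: sheaf_resZ]. Qed.

Lemma res_graded gamma gamma' : face (val gamma') (val gamma) ->
  graded_map 0 (sheaf_res E gamma gamma').
Proof. by move=> f k x hx; rewrite addr0; exact: sheaf_res_deg. Qed.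

Lemma res_proj gamma gamma' k x : face (val gamma') (val gamma) ->
  sheaf_res E gamma gamma' (gproj k x) = gproj k (sheaf_res E gamma gamma' x).
Proof.
move=> f; have := graded_map_proj k x (res_twisted f) (res_graded f).
by rewrite addr0.
Qed.

Program Definition section_proj Lambda k (s : section E Lambda) : section E Lambda :=
  @Section _ _ _ E Lambda (fun gamma => gproj k (s gamma)) _ _.
Next Obligation. by move=> * /=; rewrite res_proj // section_res. Qed.
Next Obligation. by move=> * /=; rewrite section_out // gproj0. Qed.

Lemma sectionD Lambda (s t : section E Lambda) gamma : (s + t) gamma = s gamma + t gamma.
Proof. by []. Qed.
Lemma sectionZ Lambda a (s : section E Lambda) gamma :
  (a *: s) gamma = to_cone (val gamma) a *: s gamma.
Proof. by []. Qed.
Lemma section_sum Lambda (T : Type) (r : seq T) (P : pred T) (F : T -> section E Lambda) gamma :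
  (\sum_(i <- r | P i) F i) gamma = \sum_(i <- r | P i) F i gamma.
Proof. exact: (big_morph (fun s : section E Lambda => s gamma)). Qed.

Lemma section_twisted Lambda gamma :
  twisted_linear (@to_cone R V (val gamma)) (fun s : section E Lambda => s gamma).
Proof. by split. Qed.

Variable cones : seq Delta.
Hypothesis conesP : forall gamma, gamma \in cones.

Lemma section_grading Lambda : is_grading (@section_deg R V Delta E Lambda).
Proof.
apply: (is_grading_proj (pi := @section_proj Lambda)).
- by move=> k gamma; exact: gdeg0.
- by move=> k x y hx hy gamma; exact: gdegB.
- move=> q k a x ha hx gamma; apply: gdegZ => //; exact: homog_pullback.
- by move=> k x y; apply: section_inj => gamma /=; rewrite gprojD.
- by move=> k x gamma; exact: gproj_deg.
- move=> k x hx; apply: section_inj => gamma; exact: gproj_id (hx gamma).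
- move=> k l x hx lk; apply: section_inj => gamma; exact: (gproj_off (hx gamma) lk).
move=> x; pose s gamma := projT1 (cid (gproj_supp (x gamma))).
(* Finiteness of the fan enters here: finitely many degrees serve all stalks at once. *)
pose t := undup [seq k | gamma <- cones, k <- s gamma].
exists t; apply: section_inj => gamma; rewrite section_sum /=.
have : projT1 (cid (gproj_supp (x gamma))) = s gamma by [].
case: (cid _) => s' /= [us' s0' {1}->] es'.
apply: big_seq_support => //; first exact: undup_uniq.
move=> k; apply: contraNeq => nz; rewrite mem_undup; apply/allpairsPdep.
exists gamma, k; split=> //; rewrite -es'.
by apply: contraNT nz => /s0' ->.
Qed.

Definition section_gmodule Lambda : gmodule V := GModule (section_grading Lambda).

(** * Sections over a set of cones with a largest cone *)

Section TopCone.
Variables (Lambda : set Delta) (top : Delta).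
Hypothesis (topP : Lambda top) (Lambda_top : forall gamma, Lambda gamma -> face (val gamma) (val top)).

Program Definition section_of (x : E top) : section E Lambda :=
  @Section _ _ _ E Lambda
    (fun gamma => if `[< Lambda gamma >] then sheaf_res E top gamma x else 0) _ _.
Next Obligation.
move=> x gamma gamma' /= L L' f; rewrite !asboolT //.
by apply: sheaf_res_comp => //; exact: Lambda_top.
Qed.
Next Obligation. by move=> x gamma /= L; rewrite asboolF. Qed.

Lemma section_ofE x gamma : Lambda gamma -> section_of x gamma = sheaf_res E top gamma x.
Proof. by move=> L /=; rewrite asboolT. Qed.

Lemma section_ofK x : section_of x top = x.
Proof. by rewrite section_ofE // sheaf_res_id. Qed.

Lemma section_topK (s : section E Lambda) : section_of (s top) = s.
Proof.
apply: section_inj => gamma /=; case: asboolP => L; last by rewrite section_out.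
by rewrite section_res //; exact: Lambda_top.
Qed.

Let extend : polyfun (subvs_of (cone_span (val top))) -> polyfun V :=
  pullback (vsproj (cone_span (val top))).
HB.instance Definition _ := GRing.RMorphism.on extend.

Lemma section_of_twisted : twisted_linear extend section_of.
Proof.
split=> [x y|a x]; apply: section_inj => gamma; rewrite ?sectionD ?sectionZ /=.
  by case: ifP => _; rewrite ?addr0 // raddfD.
case: asboolP => [L|_]; last by rewrite scaler0.
by rewrite sheaf_resZ; [congr (_ *: _); exact: polyfun_eq|exact: Lambda_top].
Qed.

Lemma section_max_mul (s : section E Lambda) : max_mul s -> max_mul (s top).
Proof.
apply: (@twisted_max_mul R V _ (section_gmodule Lambda) (E top)
  (@to_cone R V (val top) : {rmorphism _ -> _}) _ (fun s : section E Lambda => s top)).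
  by move=> q a; exact: homog_pullback.
exact: section_twisted.
Qed.

Lemma section_of_max_mul x : max_mul x -> max_mul (section_of x).
Proof.
apply: (@twisted_max_mul R _ V (E top) (section_gmodule Lambda)
  (extend : {rmorphism _ -> _}) _ section_of).
  by move=> q a; exact: homog_pullback.
exact: section_of_twisted.
Qed.

Lemma section_of_deg k x : gmodule_deg k x -> section_deg k (section_of x).
Proof.
move=> hx gamma /=; case: asboolP => [L|_]; last exact: gdeg0.
by apply: sheaf_res_deg => //; exact: Lambda_top.
Qed.

(** Evaluation at [top] and [section_of] are mutually inverse, semilinear over restriction of
    polynomials to the span of [top] and over their extension along [vsproj]. So a quotient over the
    ring of [V] can be computed over the ring of the cone. *)
Lemma section_bar_dim k :
  bar_dim (@section_deg R V Delta E Lambda k) = bar_dim (@gmodule_deg _ _ (E top) k).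
Proof.
rewrite /bar_dim; congr xget; apply/seteqP; split=> d /= [b hb].
  exists ((fun s : section E Lambda => s top) \o b).
  refine (bar_basis_transfer (f := fun s : section E Lambda => s top) (g := section_of)
    (section_twisted Lambda top) _ _ _ _ _ _ _ hb).
  - exact: section_max_mul.
  - exact: section_of_max_mul.
  - exact: pullbackA.
  - exact: section_topK.
  - exact: section_ofK.
  - by move=> x; exact.
  - exact: section_of_deg.
exists (section_of \o b).
refine (bar_basis_transfer (f := section_of) (g := fun s : section E Lambda => s top)
  section_of_twisted _ _ _ _ _ _ _ hb).
- exact: section_of_max_mul.
- exact: section_max_mul.
- exact: pullbackA.
- exact: section_ofK.
- exact: section_topK.
- exact: section_of_deg.
- by move=> x; exact.
Qed.

End TopCone.

Hypothesis minE : is_minimal_extension E.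

Lemma faces_top gamma : faces gamma gamma. Proof. exact: face_refl. Qed.

(** The injective half of (LME), applied to the section of the face fan defined by [x]. *)
Lemma boundary_ker gamma (x : E gamma) : val gamma <> [set 0] ->
  (forall gamma', proper_face gamma' gamma -> sheaf_res E gamma gamma' x = 0) -> max_mul x.
Proof.
move=> g0 rx; have [inj _] := minimal_LME minE g0.
rewrite -(section_ofK (faces_top gamma) (fun _ => id) x).
apply: (section_max_mul gamma); apply: inj.
set y := section_of _ x.
have y0 : section_restr (@boundary_sub _ _ _ gamma) y = 0.
  apply: section_inj => gamma' /=; case: asboolP => // -[f ne].
  by rewrite asboolT //; apply: rx.
by move: (max_mul0 (section_gmodule (boundary gamma))); rewrite -y0.
Qed.

(** The surjective half of (LME) lifts only modulo $\mathfrak m$; Nakayama over the boundary makes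
    the lift exact, with [bd] as the lower bound it requires. *)
Lemma boundary_surj gamma : val gamma <> [set 0] ->
  (forall gamma' k (x : E gamma'), proper_face gamma' gamma -> k < 0 ->
    gmodule_deg k x -> x = 0) ->
  forall f : forall gamma', E gamma',
  (forall gamma' gamma'', proper_face gamma' gamma -> proper_face gamma'' gamma ->
    face (val gamma'') (val gamma') -> sheaf_res E gamma' gamma'' (f gamma') = f gamma'') ->
  exists y : E gamma, forall gamma', proper_face gamma' gamma ->
    sheaf_res E gamma gamma' y = f gamma'.
Proof.
move=> g0 bd f fc; have [_ surj] := minimal_LME minE g0.
have [s sf] : exists s : section E (boundary gamma), forall gamma', boundary gamma gamma' ->
    s gamma' = f gamma'.
  unshelve eexists.
    refine (@Section _ _ _ E (boundary gamma)
      (fun gamma' => if `[< boundary gamma gamma' >] then f gamma' else 0) _ _).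
    - by move=> g' g'' b' b'' fa; rewrite !asboolT //; apply: fc.
    - by move=> g' b' /=; rewrite asboolF.
  by move=> g' b' /=; rewrite asboolT.
have [|||t st] := @graded_nakayama R V (section_gmodule (faces gamma))
  (section_gmodule (boundary gamma)) (section_restr (@boundary_sub _ _ _ gamma)) _ _ _ surj s.
- exists 0 => k x k0 hx; apply: section_inj => gamma'.
  case: (pselect (boundary gamma gamma')) => b; last by rewrite section_out.
  exact: bd b k0 (hx gamma').
- by split=> [x y|a x]; [exact: linearD|exact: linearZ].
- move=> k x hx gamma' /=; rewrite addr0.
  by case: ifP => _; [exact: hx|exact: gdeg0].
exists (t gamma) => gamma' b; rewrite -(sf _ b) st /=.
have [fa _] := b.
by rewrite asboolT // section_res //; exact: face_refl.
Qed.

(** By induction on the dimension, elements of negative degree vanish on all proper faces and so lie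
    in $\mathfrak m E_\gamma$; freeness then excludes them. The zero cone is covered by (N). *)
Lemma stalk_bounded gamma k (x : E gamma) : k < 0 -> gmodule_deg k x -> x = 0.
Proof.
move En: (\dim (cone_span (val gamma))) => n.
elim/ltn_ind: n gamma En k x => n IHn gamma En k x.
case: (pselect (val gamma = [set 0])) => g0.
  have [f [[g fK gK] fZ fdeg]] := minimal_N minE g0.
  move=> k0 hx; rewrite -[x]fK -[RHS]fK raddf0 (fdeg _ _ hx) //.
  by rewrite lt_eqF.
move: k x; apply: free_bounded_below; first exact: minimal_PF.
move=> k x k0 hx; apply: boundary_ker => // gamma' pf.
have := proper_face_dim pf; rewrite En => /IHn; apply=> //; first exact: k0.
by case: pf => f _; exact: sheaf_res_deg.
Qed.

Lemma boundary_lift gamma : val gamma <> [set 0] ->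
  forall f : forall gamma', E gamma',
  (forall gamma' gamma'', proper_face gamma' gamma -> proper_face gamma'' gamma ->
    face (val gamma'') (val gamma') -> sheaf_res E gamma' gamma'' (f gamma') = f gamma'') ->
  exists y : E gamma, forall gamma', proper_face gamma' gamma ->
    sheaf_res E gamma gamma' y = f gamma'.
Proof.
by move=> g0; apply: boundary_surj => // gamma' k x _; exact: stalk_bounded.
Qed.

(** Double induction, on the dimension of the cone and on the degree: the outer one handles the
    proper faces, the inner one the kernel of restriction to the boundary. *)
Lemma stalk_fin gamma k : fin_deg (E gamma) k.
Proof.
move En: (\dim (cone_span (val gamma))) => n.
elim/ltn_ind: n gamma En k => n IHn gamma En k.
have fin0 l : l < 0 -> fin_deg (E gamma) l.
  move=> l0; exists 0%N, (fun=> 0); split=> [[]//|x hx].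
  by exists (fun=> 0); rewrite big_ord0; exact: stalk_bounded l0 hx.
case: (pselect (val gamma = [set 0])) => g0.
  have [f [[g fK gK] fZ fdeg]] := minimal_N minE g0.
  apply: (@fin_dim_span R (real_module (E gamma)) _ (fun _ : 'I_1 => g 1)).
    exact: subspace_deg.
  move=> x _; exists (fun=> f x); rewrite big_ord1 -[LHS]fK.
  apply: (can_inj fK); rewrite fK.
  transitivity (f ((f x)%:A *: (g 1 : E gamma))); last by [].
  by rewrite fZ gK polyfunA mulr1.
suff H m : forall k, k < m%:Z -> fin_deg (E gamma) k.
  by apply: (H `|k|%N.+1); lia.
elim: m => [|m IHm] {}k km; first exact: fin0.
(* Elements allowed to be nonzero only on the proper faces listed in [s]. The empty list gives the
   kernel, the list [cones] the whole degree, and each added face enlarges the space by a finite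
   dimensional image. *)
pose Q (s : seq Delta) := @fin_dim R (real_module (E gamma)) (fun x => gmodule_deg k x /\
  forall gamma', gamma' \notin s -> proper_face gamma' gamma -> sheaf_res E gamma gamma' x = 0).
have sQ (s : seq Delta) : @subspace R (real_module (E gamma)) (fun x => gmodule_deg k x /\
  forall gamma', gamma' \notin s -> proper_face gamma' gamma -> sheaf_res E gamma gamma' x = 0).
  split; first by split=> [|g' _ _]; [exact: gdeg0|exact: raddf0].
  move=> a x y [hx rx] [hy ry]; split.
    by apply: gdegD => //; exact: gdegZA.
  move=> g' gs pf; have [fa _] := pf.
  rewrite (twistedD (res_twisted fa)) (ry _ gs pf) addr0.
  by rewrite (twistedZ (res_twisted fa)) (rx _ gs pf) scaler0.
suff QP s : Q s.
  apply: fin_dimS (QP cones); first exact: subspace_deg.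
  by move=> x hx; split=> // g'; rewrite conesP.
elim: s => [|g' s Qs].
  apply: fin_dimS (fin_dim_max_mul (M := E gamma) (k := k) _); first exact: sQ.
    by move=> x [hx rx]; split=> //; apply: boundary_ker => // g' pf; exact: rx.
  by move=> l lk; apply: IHm; lia.
case: (pselect (proper_face g' gamma)) => pf; last first.
  apply: fin_dimS Qs; first exact: sQ.
  move=> x [hx rx]; split=> // g'' gs pf'; apply: rx => //.
  by rewrite inE negb_or gs andbT; apply/eqP => e; apply: pf; rewrite -e.
have [fa _] := pf.
have [n' [b [_ spb]]] : fin_deg (E g') k.
  by apply: (IHn _ _ g' erefl k); rewrite -En; exact: proper_face_dim.
apply: (@fin_dim_extension R (real_module (E gamma)) (real_module (E g'))
  (sheaf_res E gamma g') _ b); [|exact: sQ| |].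
- move=> a x y; rewrite (twistedD (res_twisted fa)) (twistedZ (res_twisted fa)).
  by congr (_ + _); exact: (congr1 (fun c => c *: sheaf_res E gamma g' x) (pullbackA _ a)).
- by move=> x [hx _]; apply: spb; exact: sheaf_res_deg.
apply: fin_dimS Qs.
  have [s0 sD] := sQ (g' :: s); split; first by split=> //; exact: raddf0.
  move=> a x y [hx rx] [hy ry]; split; first exact: sD.
  by rewrite (twistedD (res_twisted fa)) (twistedZ (res_twisted fa)) rx ry scaler0 addr0.
move=> x [[hx rx] rx']; split=> // g'' gs pf'.
case: (eqVneq g'' g') => [->//|ne]; apply: rx => //.
by rewrite inE negb_or ne.
Qed.

End Stalks.

(** * Comparison of two systems of graded modules *)

(** Choice along a rank: all values of one rank are chosen together, which is possible because [Q]
    relates only elements of different ranks. *)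
Lemma build_family (I : Type) (X : I -> Type) (x0 : forall i, X i) (r : I -> nat) (n0 : nat)
    (P : forall i, X i -> Prop) (Q : forall i j, X i -> X j -> Prop) :
  (forall i, (r i < n0)%N) ->
  (forall i (f : forall j, X j), (forall j, (r j < r i)%N ->
      P j (f j) /\ forall k, (r k < r j)%N -> Q j k (f j) (f k)) ->
    exists x, P i x /\ forall j, (r j < r i)%N -> Q i j x (f j)) ->
  exists f : forall i, X i, forall i,
    P i (f i) /\ forall j, (r j < r i)%N -> Q i j (f i) (f j).
Proof.
move=> rn0 step.
suff H n : exists f : forall i, X i, forall i, (r i < n)%N ->
    P i (f i) /\ forall j, (r j < r i)%N -> Q i j (f i) (f j).
  by have [f hf] := H n0; exists f => i; exact: hf.
elim: n => [|n [f hf]]; first by exists x0.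
have ex i : exists x, r i = n -> P i x /\ forall j, (r j < n)%N -> Q i j x (f j).
  case: (pselect (r i = n)) => [rin|nr]; last by exists (x0 i).
  have [|x hx] := step i f; first by move=> j; rewrite rin => /hf.
  by exists x => _; rewrite -rin.
pose g i : X i := if r i == n then projT1 (cid (ex i)) else f i.
have gf j : (r j < n)%N -> g j = f j by move=> rj; rewrite /g ltn_eqF.
exists g => i; rewrite ltnS leq_eqVlt => /orP[/eqP rin|rin]; last first.
  rewrite gf //; have [Pi Qi] := hf i rin; split=> // j rj.
  by rewrite gf; [exact: Qi|exact: ltn_trans rin].
have -> : g i = projT1 (cid (ex i)) by rewrite /g; case: eqP.
case: (cid (ex i)) => x /= /(_ rin)[Px Qx]; split=> // j rj.
by rewrite gf; [apply: Qx|]; rewrite -rin.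
Qed.

(* the sheaves of modules to be compared, with the cones replaced by an abstract
   index set, so that one index set serves Delta_tau and the cones containing tau *)
Record msystem (R : realType) (I : Type) (lt : I -> I -> Prop) := MSystem {
  sspace : I -> vectType R;
  smod :> forall i, gmodule (sspace i);
  sring : forall i j, polyfun (sspace i) -> polyfun (sspace j);
  sres : forall i j, smod i -> smod j;
  sres_twisted : forall i j, lt j i -> twisted_linear (@sring i j) (@sres i j);
  sres_graded : forall i j, lt j i -> graded_map 0 (@sres i j);
  sres_comp : forall i j k (x : smod i), lt j i -> lt k j ->
    @sres j k (@sres i j x) = @sres i k x }.
Arguments sring {R I lt} m i j _.
Arguments sres {R I lt m} i j _.
Arguments sres_twisted {R I lt} m {i j} _.
Arguments sres_graded {R I lt} m {i j} _ _ _ _.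
Arguments sres_comp {R I lt} m {i j k} _ _ _.

Section Extension.
Variables (R : realType) (I : Type) (lt : I -> I -> Prop) (r : I -> nat) (n0 : nat).
Hypotheses (rn0 : forall i, (r i < n0)%N) (ltr : forall i j, lt j i -> (r j < r i)%N).
Variables (M N : msystem R lt).

Definition boundary_lifts (i : I) : Prop := forall f : forall j, N j,
  (forall j k, lt j i -> lt k i -> lt k j -> sres j k (f j) = f k) ->
  exists y : N i, forall j, lt j i -> sres i j y = f j.

Variable theta : forall i, {rmorphism polyfun (sspace M i) -> polyfun (sspace N i)}.
Hypothesis theta_homog : forall i q a, homog q a -> homog q (theta i a).
Hypothesis theta_res : forall i j a, lt j i ->
  theta j (sring M i j a) = sring N i j (theta i a).

Definition system_map (d : int) (F : forall i, M i -> N i) : Prop := forall i,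
  [/\ twisted_linear (theta i) (F i), graded_map d (F i) &
      forall j x, lt j i -> sres i j (F i x) = F j (sres i j x)].

(** At each further index the values on smaller ones form a compatible family; lifts exist for
    single elements because the target is flabby, and for a whole map because the source is free. *)
Lemma extend_system_map (o : I) (d : int) (fo : M o -> N o) :
  (forall j, ~ lt j o) -> twisted_linear (theta o) fo -> graded_map d fo ->
  (forall i, free_module (M i)) -> (forall i, i <> o -> boundary_lifts i) ->
  exists F, system_map d F /\ F o = fo.
Proof.
move=> omin fol fod freeM surjN.
(* The last clause pins the component at [o] to [fo]; the types require a transport along
   [o = i]. *)
pose P i (f : M i -> N i) := [/\ twisted_linear (theta i) f, graded_map d f &
  forall e : o = i, f = match e in _ = j return M j -> N j with erefl => fo end].
pose Q i j (f : M i -> N i) (g : M j -> N j) :=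
  lt j i -> forall x, sres i j (f x) = g (sres i j x).
have [|F hF] := @build_family I (fun i => M i -> N i) (fun i _ => 0) r n0 P Q rn0; last first.
  exists F; split=> [i|]; last by have [[_ _ h] _] := hF o; exact: h erefl.
  have [[Fl Fd _] Fr] := hF i; split=> // j x ji; exact: Fr (ltr ji) ji x.
move=> i F hF; case: (pselect (i = o)) => [->|io].
  exists fo; split; last by move=> j _ /omin.
  split=> // e; rewrite (Prop_irrelevance e erefl) //.
pose K (x : M i) (y : N i) := forall j, lt j i -> sres i j y = F j (sres i j x).
have hFl j (ji : lt j i) : twisted_linear (theta j) (F j).
  by have [[]] := hF j (ltr ji).
have hFd j (ji : lt j i) : graded_map d (F j).
  by have [[]] := hF j (ltr ji).
have [||||f [fl fd fK]] := @graded_free_lift _ _ _ _ _ (theta i) (@theta_homog i) d K (freeM i).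
- move=> j ji; rewrite (twisted0 (sres_twisted N ji)) (twisted0 (sres_twisted M ji)).
  by rewrite (twisted0 (hFl j ji)).
- move=> a x y x' y' hx hx' j ji.
  rewrite (twistedD (sres_twisted N ji)) (twistedZ (sres_twisted N ji)) hx // hx' //.
  rewrite (twistedD (sres_twisted M ji)) (twistedZ (sres_twisted M ji)).
  by rewrite (twistedD (hFl j ji)) (twistedZ (hFl j ji)) theta_res.
- move=> k x y hx Kxy j ji.
  have := graded_map_proj (k + d) y (sres_twisted N ji) (sres_graded N ji).
  rewrite addr0 => <-; rewrite Kxy // gproj_id //; apply: hFd => //.
  by rewrite -[k]addr0; exact: sres_graded.
- move=> x; apply: (surjN i io (fun j => F j (sres i j x))) => j k ji ki kj.
  have [_ hQ] := hF j (ltr ji).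
  by rewrite (hQ k (ltr kj) kj) sres_comp.
exists f; split; first by split=> // e; case: io.
by move=> j _ ji x; exact: fK.
Qed.

End Extension.

Section PowerMaxMul.
Variables (R : realType) (W : vectType R) (M : gmodule W) (J : finType) (d : J -> int).
Local Notation P := (power_gmodule M d).

Lemma power_max_mul (h : P) : max_mul h <-> forall j, max_mul (h j).
Proof.
split=> [mh j|mh].
  apply: (@twisted_max_mul R W W P M id _ (fun h : P => h j) h _ mh) => //.
  by split=> [x y|a x]; rewrite ffunE.
pose single j (x : M) : P := [ffun j' => if j' == j then x else 0].
have -> : h = \sum_j single j (h j).
  apply/ffunP => j; rewrite sum_ffunE (bigD1 j) //= big1 ?addr0; first by rewrite ffunE eqxx.
  by move=> j' jj'; rewrite ffunE eq_sym (negbTE jj').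
apply: (@max_mul_sum _ _ P) => j _.
apply: (@twisted_max_mul R W W M P id _ (single j)) => //.
split=> [x y|a x]; apply/ffunP => j'; rewrite !ffunE.
  by case: ifP => _; rewrite ?addr0.
by case: ifP => _; rewrite ?scaler0.
Qed.

End PowerMaxMul.

(** * A matrix of endomorphisms that is the identity at the bottom *)

Section SelfMaps.
Variables (R : realType) (I : Type) (lt : I -> I -> Prop) (r : I -> nat).
Hypothesis ltr : forall i j, lt j i -> (r j < r i)%N.
Variables (H : msystem R lt) (o : I).
Hypotheses (lifts : forall i, i <> o -> boundary_lifts H i)
  (ker : forall i (x : H i), i <> o -> (forall j, lt j i -> sres i j x = 0) -> max_mul x)
  (bounded : forall i k (x : H i), k < 0 -> gmodule_deg k x -> x = 0)
  (fin : forall i k, fin_deg (H i) k).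
Variables (J : finType) (d : J -> int) (t : J -> J -> forall i, H i -> H i).
Hypotheses (d0 : forall j, 0 <= d j)
  (tl : forall j j' i, twisted_linear id (t j j' (i := i)))
  (td : forall j j' i, graded_map (d j' - d j) (t j j' (i := i)))
  (tr : forall j j' i k x, lt k i -> sres i k (t j j' x) = t j j' (sres i k x))
  (t_o : forall j j' x, t j j' (i := o) x = if j == j' then x else 0).

Local Notation P i := (power_gmodule (H i) d).

Definition matrix_map i (h : P i) : P i := [ffun j => \sum_j' t j j' (h j')].

Lemma matrix_map_twisted i : twisted_linear id (@matrix_map i).
Proof.
split=> [x y|a x]; apply/ffunP => j; rewrite !ffunE.
  by rewrite -big_split; apply: eq_bigr => j' _; rewrite ffunE (twistedD (tl _ _ _)).
by rewrite scaler_sumr; apply: eq_bigr => j' _; rewrite ffunE (twistedZ (tl _ _ _)).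
Qed.

Lemma matrix_map_graded i : graded_map 0 (@matrix_map i).
Proof.
move=> k h hh; rewrite addr0 => /= j; rewrite ffunE; apply: gdeg_sum => j' _.
by have := @td j j' i _ _ (hh j'); rewrite subrKA.
Qed.

Let power_res i k (h : P i) : P k := [ffun j => sres i k (h j)].

Lemma matrix_map_res i k (h : P i) : lt k i ->
  power_res k (matrix_map h) = matrix_map (power_res k h).
Proof.
move=> ki; apply/ffunP => j; rewrite !ffunE (twisted_sum (sres_twisted H ki)).
by apply: eq_bigr => j' _; rewrite ffunE tr.
Qed.

Lemma matrix_map_o (h : P o) : matrix_map h = h.
Proof.
apply/ffunP => j; rewrite ffunE (bigD1 j) //= t_o eqxx big1 ?addr0 // => j' jj'.
by rewrite t_o eq_sym (negbTE jj').
Qed.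

(** To solve the equation for [h] modulo $\mathfrak m$, invert the matrix on each smaller index,
    lift the solutions to [i], and note that the error restricts to zero there, so that [ker]
    applies. *)
Lemma matrix_map_bij i : (forall y, exists x, y = @matrix_map i x) /\
  (forall x, @matrix_map i x = 0 -> x = 0).
Proof.
move Ei: (r i) => n; elim/ltn_ind: n i Ei => n IHn i Ei.
case: (pselect (i = o)) => [->|io].
  by split=> [y|x]; [exists y|]; rewrite matrix_map_o.
have IH k (ki : lt k i) : (forall y, exists x, y = @matrix_map k x) /\
  (forall x, @matrix_map k x = 0 -> x = 0).
  by apply: (IHn (r k)) => //; rewrite -Ei; exact: ltr.
have surj : forall y, exists x, y = @matrix_map i x.
  apply: graded_nakayama (matrix_map_twisted i) (@matrix_map_graded i) _.
    by apply: power_bounded d0 => k x; exact: bounded.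
  move=> h.
  have exg k : exists g : P k, lt k i -> power_res k h = matrix_map g.
    case: (pselect (lt k i)) => ki; last by exists 0.
    by have [g hg] := (IH k ki).1 (power_res k h); exists g.
  pose g k : P k := projT1 (cid (exg k)).
  have hg k : lt k i -> power_res k h = matrix_map (g k) := projT2 (cid (exg k)).
  have gc k l : lt k i -> lt l i -> lt l k -> power_res l (g k) = g l.
    (* The two candidates on [l] have the same image under the matrix, which is injective there by
       induction. *)
    move=> ki li lk; apply/eqP; rewrite -subr_eq0; apply/eqP.
    apply: (IH l li).2; rewrite (twistedB (matrix_map_twisted l)) -matrix_map_res //.
    rewrite -!hg //; apply/eqP; rewrite subr_eq0; apply/eqP/ffunP => j.
    by rewrite !ffunE sres_comp.
  have exy j : exists y : H i, forall k, lt k i -> sres i k y = g k j.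
    apply: (lifts io (f := fun k => g k j)) => k l ki li lk.
    by rewrite -(gc k l) // ffunE.
  have [y hy] := choice exy.
  exists [ffun j => y j]; apply/power_max_mul => j; apply: ker => // k ki.
  rewrite !ffunE (twistedB (sres_twisted H ki)) (twisted_sum (sres_twisted H ki)).
  have /ffunP/(_ j) := hg k ki; rewrite !ffunE => ->.
  apply/eqP; rewrite subr_eq0; apply/eqP; apply: eq_bigr => j' _.
  by rewrite tr // ffunE hy.
split=> //; apply: graded_surjective_injective => //.
- by apply: power_fin_deg => k.
- exact: matrix_map_twisted.
- exact: matrix_map_graded.
Qed.

(** A surjective linear map sends $\mathfrak m P$ onto $\mathfrak m P$, and injectivity identifies
    the preimage. *)
Lemma matrix_map_max_mul i (h : P i) : max_mul (matrix_map h) -> max_mul h.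
Proof.
have [surj inj] := matrix_map_bij i; have Tl := matrix_map_twisted i.
move=> mTh; suff [x mx ex] : exists2 x, max_mul x & matrix_map h = matrix_map x.
  suff -> : h = x by [].
  by apply/eqP; rewrite -subr_eq0; apply/eqP/inj; rewrite (twistedB Tl) ex subrr.
move: (matrix_map h) mTh; apply: (@max_mul_ind _ _ (P i)).
- by exists 0; [exact: (max_mul0 (P i))|rewrite (twisted0 Tl)].
- move=> _ _ [x mx ->] [y my ->]; exists (x + y); first exact: (@max_mulD _ _ (P i)).
  by rewrite (twistedD Tl).
move=> q a x q0 ha; have [y ->] := surj x; exists (a *: y); last by rewrite (twistedZ Tl).
exact: (@max_mul_homog _ _ (P i) q).
Qed.

End SelfMaps.

(** The functionals dual to [b], extended to [M] through projection to degree [k]; since they kill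
    $\mathfrak m M$, a polynomial acts through its constant term. *)
Lemma bar_coordinates (R : realType) (W : vectType R) (M : gmodule W) k n (b : 'I_n -> M) :
  bar_basis (@gmodule_deg R W M k) b ->
  exists v : 'I_n -> M -> R, [/\ forall i x y, v i (x + y) = v i x + v i y,
    forall i (a : polyfun W) x, v i (a *: x) = a 0 * v i x,
    forall i j, v i (b j) = (i == j)%:R &
    forall i l x, gmodule_deg l x -> l != k -> v i x = 0].
Proof.
move=> [Db indb spb].
have ex (x : M) : exists c : 'I_n -> R, max_mul (gproj k x - \sum_i (c i)%:A *: b i).
  exact: spb (gproj_deg k x).
have [v hv] := choice ex.
(* Coefficients are unique modulo $\mathfrak m M$, so each property of the chosen [v] follows by
   exhibiting suitable coefficients. *)
have vP x c : max_mul (gproj k x - \sum_i (c i)%:A *: b i) -> forall i, v x i = c i.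
  move=> hc i; apply/eqP; rewrite -subr_eq0; apply/eqP; move: i; apply: indb.
  have := max_mulB hc (hv x).
  rewrite opprB addrC addrA subrK -sumrB; congr max_mul; apply: eq_bigr => i _.
  by rewrite !scalerBl.
exists (fun i x => v x i); split=> [i x y|i a x|i j|i l x hx lk].
- apply: (vP _ (fun i => v x i + v y i)).
  have := max_mulD (hv x) (hv y); rewrite addrACA -opprD -big_split gprojD.
  congr (max_mul (_ - _)); apply: eq_bigr => j _; by rewrite !scalerDl.
- apply: (vP _ (fun i => a 0 * v x i)).
  have := max_mulD (max_mul_proj k (scale_at0 a x)) (max_mulZ (a 0)%:A (hv x)).
  have e : gproj k ((a 0)%:A *: x) = (a 0)%:A *: gproj k x.
    by have := gprojZ k x (homog_cst W (a 0)); rewrite addr0.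
  rewrite gprojB e scalerBr addrA subrK scaler_sumr.
  congr (max_mul (_ - _)); apply: eq_bigr => j _.
  by rewrite scalerA; congr (_ *: _); apply: polyfun_eq => w; rewrite polyfunM !polyfunA.
- apply: (vP _ (fun i => (i == j)%:R)).
  rewrite gproj_id // (bigD1 j) //= eqxx !scale1r big1 ?addr0 ?subrr; first exact: max_mul0.
  by move=> i' /negbTE ->; rewrite !scale0r.
- apply: (vP _ (fun=> 0)); rewrite (gproj_off hx) 1?eq_sym // big1 ?subrr; first exact: max_mul0.
  by move=> j _; rewrite !scale0r.
Qed.

(** * The inequality for two abstract systems *)

Section Core.
Variables (R : realType) (I : Type) (lt : I -> I -> Prop) (r : I -> nat) (n0 : nat).
Hypotheses (rn0 : forall i, (r i < n0)%N) (ltr : forall i j, lt j i -> (r j < r i)%N).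
Variables (H E : msystem R lt) (o : I).
Hypothesis omin : forall j, ~ lt j o.
Variables (theta : forall i, {rmorphism polyfun (sspace H i) -> polyfun (sspace E i)})
  (eta : forall i, {rmorphism polyfun (sspace E i) -> polyfun (sspace H i)}).
Hypotheses (theta_homog : forall i q a, homog q a -> homog q (theta i a))
  (eta_homog : forall i q a, homog q a -> homog q (eta i a))
  (etaK : forall i a, eta i (theta i a) = a)
  (theta_res : forall i j a, lt j i -> theta j (sring H i j a) = sring E i j (theta i a))
  (eta_res : forall i j a, lt j i -> eta j (sring E i j a) = sring H i j (eta i a)).
Hypotheses (freeH : forall i, free_module (H i)) (freeE : forall i, free_module (E i))
  (liftsH : forall i, i <> o -> boundary_lifts H i)
  (liftsE : forall i, i <> o -> boundary_lifts E i)
  (kerH : forall i (x : H i), i <> o -> (forall j, lt j i -> sres i j x = 0) -> max_mul x)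
  (boundedH : forall i k (x : H i), k < 0 -> gmodule_deg k x -> x = 0)
  (finH : forall i k, fin_deg (H i) k) (finE : forall i k, fin_deg (E i) k).
Hypotheses (cst_o : forall a : polyfun (sspace H o), a = (a 0)%:A)
  (thetaA : forall i (c : R), theta i c%:A = c%:A)
  (eta_o : forall a, (eta o a) 0 = a 0) (isoH : iso_trivial (H o)).

Lemma extend_from_bottom (d : int) (e : E o) : gmodule_deg d e ->
  forall u : {additive H o -> R}, (forall a x, u (a *: x) = a 0 * u x) ->
  (forall k x, gmodule_deg k x -> k != 0 -> u x = 0) ->
  exists F, system_map theta d F /\ F o = (fun x : H o => (u x)%:A *: e).
Proof.
move=> he u uZ udeg; apply: (@extend_system_map R I lt r n0) => //.
  split=> [x y|a x]; first by rewrite raddfD !scalerDl.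
  rewrite uZ {2}[a]cst_o thetaA scalerA; congr (_ *: _).
  by apply: polyfun_eq => w; rewrite polyfunM !polyfunA.
move=> k x hx; case: (eqVneq k 0) => [->|k0].
  by rewrite add0r; exact: gdegZA.
by rewrite (udeg k) // !scale0r; exact: gdeg0.
Qed.

(** Although the ring of [E o] may be large, it acts on the values of [v] through constant terms, so
    composing with the inverse of [u] gives a map semilinear over [eta o]. *)
Lemma extend_to_bottom (d : int) (v : E o -> R) : (forall x y, v (x + y) = v x + v y) ->
  (forall a x, v (a *: x) = a 0 * v x) ->
  (forall k x, gmodule_deg k x -> k != d -> v x = 0) ->
  forall (u : {additive H o -> R}) (u' : R -> H o), cancel u u' -> cancel u' u ->
  (forall a x, u (a *: x) = a 0 * u x) ->
  (forall k x, gmodule_deg k x -> k != 0 -> u x = 0) ->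
  exists F, system_map eta (- d) F /\ F o = u' \o v.
Proof.
move=> vD vZ vdeg u u' uK u'K uZ udeg; apply: (@extend_system_map R I lt r n0) => //.
  split=> [x y|a x] /=; apply: (can_inj uK); first by rewrite raddfD !u'K.
  by rewrite uZ !u'K eta_o vZ.
(* The inverse of [u] is homogeneous too: components in other degrees are killed by [u], which is
   injective. *)
have deg0 x : gmodule_deg 0 (u' x).
  rewrite (_ : u' x = gproj 0 (u' x)); first exact: gproj_deg.
  have [s [us s0 {1}->]] := gproj_supp (u' x).
  have z k : k != 0 -> gproj k (u' x) = 0.
    move=> k0; apply: (can_inj uK); rewrite raddf0; apply: (udeg k) k0.
    exact: gproj_deg.
  rewrite -[RHS](big_seq1 +%R 0 (fun k => gproj k (u' x))).
  by apply: big_seq_support => // k; rewrite inE => /z.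
move=> k x hx; case: (eqVneq k d) => [->|kd] /=; first by rewrite subrr.
rewrite (vdeg k) // (_ : u' 0 = 0); first exact: gdeg0.
by apply: (can_inj uK); rewrite u'K raddf0.
Qed.

Lemma leq_bar_dim_system (i : I) (k : nat) :
  (\sum_(l < k.+1) bar_dim (@gmodule_deg _ _ (E o) l%:Z) *
     bar_dim (@gmodule_deg _ _ (H i) (k - l)%N%:Z)
   <= bar_dim (@gmodule_deg _ _ (E i) k%:Z))%N.
Proof.
have [u [[u' uK u'K] uZ udeg]] := isoH.
pose n (l : nat) := bar_dim (@gmodule_deg _ _ (E o) l%:Z).
have exb l : exists b : 'I_(n l) -> E o, bar_basis (@gmodule_deg _ _ (E o) l%:Z) b.
  exact: bar_dimP.
pose b l := projT1 (cid (exb l)).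
have hb l : bar_basis (@gmodule_deg _ _ (E o) l%:Z) (b l) := projT2 (cid (exb l)).
pose v l := projT1 (cid (bar_coordinates (hb l))).
have hv l : [/\ forall i x y, v l i (x + y) = v l i x + v l i y,
    forall i a x, v l i (a *: x) = a 0 * v l i x,
    forall i j, v l i (b l j) = (i == j)%:R &
    forall i m x, gmodule_deg m x -> m != l%:Z -> v l i x = 0] :=
  projT2 (cid (bar_coordinates (hb l))).
(* Basis elements of the bottom quotient in all degrees up to [k]; larger degrees cannot contribute
   to degree [k]. *)
pose J : finType := {l : 'I_k.+1 & 'I_(n l)}.
pose d (j : J) : int := (tag j)%:Z.
pose e (j : J) : E o := b (tag j) (tagged j).
have edeg j : gmodule_deg (d j) (e j) by have [h _ _] := hb (tag j); exact: h.
have exphi j := extend_from_bottom (edeg j) uZ udeg.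
pose phi j := projT1 (cid (exphi j)).
have phiP j : system_map theta (d j) (phi j) /\
    phi j o = (fun x : H o => (u x)%:A *: e j) := projT2 (cid (exphi j)).
have expsi (j : J) : exists F, system_map eta (- d j) F /\ F o = u' \o v (tag j) (tagged j).
  by have [vD vZ _ vdeg] := hv (tag j);
    exact: (extend_to_bottom (vD _) (vZ _) (vdeg _) uK u'K uZ udeg).
pose psi j := projT1 (cid (expsi j)).
have psiP j : system_map eta (- d j) (psi j) /\
    psi j o = u' \o v (tag j) (tagged j) := projT2 (cid (expsi j)).
pose t (j j' : J) l (x : H l) : H l := psi j l (phi j' l x).
have d0 j : 0 <= d j by [].
have tl j j' l : twisted_linear id (@t j j' l).
  have [phil _ _] := (phiP j').1 l; have [psil _ _] := (psiP j).1 l.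
  split=> [x y|a x]; first by rewrite /t (twistedD phil) (twistedD psil).
  by rewrite /t (twistedZ phil) (twistedZ psil) etaK.
have td j j' l : graded_map (d j' - d j) (@t j j' l).
  have [_ phid _] := (phiP j').1 l; have [_ psid _] := (psiP j).1 l.
  by move=> m x hx; rewrite addrA; apply: psid; exact: phid.
have tr j j' l m x : lt m l -> sres l m (@t j j' l x) = t j j' m (sres l m x).
  have [_ _ phir] := (phiP j').1 l; have [_ _ psir] := (psiP j).1 l.
  by move=> ml; rewrite /t psir // phir.
have t_o j j' x : @t j j' o x = if j == j' then x else 0.
  rewrite /t (psiP j).2 (phiP j').2 /=; have [_ vZ vb vdeg] := hv (tag j).
  apply: (can_inj uK); rewrite u'K vZ polyfunA.
  case: (eqVneq j j') => [<-|jj']; first by rewrite vb eqxx mulr1.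
  (* Off the diagonal there are two reasons for zero: a dual basis within one degree, and the degree
     of the functional between different degrees. *)
  rewrite raddf0 /e; case: j j' jj' {vb vZ} vdeg => [l a] [l' a'] /= jj' vdeg.
  case: (eqVneq l l') => [ll'|ll'].
    case: l' / ll' a' jj' => a' jj'; have [_ _ vb _] := hv l.
    rewrite vb; case: eqP => [aa'|]; last by rewrite mulr0.
    by rewrite aa' eqxx in jj'.
  by rewrite (vdeg _ l'%:Z) ?mulr0 //; [have [+ _ _] := hb l'; exact|rewrite eq_sym].
pose nH (j : J) := bar_dim (@gmodule_deg _ _ (H i) (k - tag j)%N%:Z).
have exc (j : J) : exists c : 'I_(nH j) -> H i,
    bar_basis (@gmodule_deg _ _ (H i) (k - tag j)%N%:Z) c by exact: bar_dimP.
pose c (j : J) := projT1 (cid (exc j)).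
have hc (j : J) : bar_basis (@gmodule_deg _ _ (H i) (k - tag j)%N%:Z) (c j) :=
  projT2 (cid (exc j)).
pose T : finType := {j : J & 'I_(nH j)}.
pose w (s : T) : E i := phi (tag s) i (c (tag s) (tagged s)).
have cardT : #|T| = (\sum_(l < k.+1) n l *
    bar_dim (@gmodule_deg _ _ (H i) (k - l)%N%:Z))%N.
  rewrite card_tagged sumnE big_map big_enum /=.
  transitivity (\sum_(l < k.+1) \sum_(a < n l) nH (Tagged (fun l : 'I_k.+1 => 'I_(n l)) a))%N.
    by rewrite sig_big_dep; apply: eq_bigr => -[l a] _; rewrite card_ord.
  by apply: eq_bigr => l _; rewrite /nH /= sum_nat_const card_ord.
rewrite -cardT; apply: (leq_bar_dim (u := w)) => //.
  move=> s; have [_ phid _] := (phiP (tag s)).1 i; have [cdeg _ _] := hc (tag s).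
  have := phid _ _ (cdeg (tagged s)); rewrite /d -PoszD subnK //.
  by rewrite -ltnS ltn_ord.
move=> z mz.
(* The coefficients of a relation, assembled into a vector. Applying [psi] to the relation yields
   the matrix applied to [h], so [h] lies in $\mathfrak m P$, and independence of each [c j] gives
   zero. *)
pose h : power_gmodule (H i) d := [ffun j => \sum_a (z (Tagged (fun j => 'I_(nH j)) a))%:A *: c j a].
suff mh : max_mul h.
  move=> [j a]; have /power_max_mul/(_ j) := mh; rewrite ffunE.
  have [_ indc _] := hc j; move=> /indc h0; exact: h0 a.
apply: (matrix_map_max_mul ltr liftsH kerH boundedH finH d0 tl td tr t_o).
apply/power_max_mul => j; rewrite ffunE.
have [psil _ _] := (psiP j).1 i.
have -> : \sum_j' t j j' i (h j') = psi j i (\sum_s (z s)%:A *: w s).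
  rewrite (twisted_sum psil).
  transitivity (\sum_j' \sum_(a < nH j')
      psi j i ((z (Tagged (fun j : J => 'I_(nH j)) a))%:A *: phi j' i (c j' a))); last first.
    by rewrite sig_big_dep; apply: eq_bigr => -[].
  apply: eq_bigr => j' _.
  rewrite ffunE (twisted_sum (tl j j' i)); apply: eq_bigr => a _.
  rewrite (twistedZ (tl _ _ _)) (twistedZ psil); congr (_ *: _).
  by rewrite -[in RHS](thetaA i) etaK.
exact: (twisted_max_mul (@eta_homog i) psil mz).
Qed.

End Core.

(** * Cones and their faces *)

Lemma set_type_elt (T : Type) (A : set T) (x : T) : A x -> exists a : A, val a = x.
Proof. by move=> Ax; exists (exist (fun x => x \in A) x (mem_set Ax)). Qed.

Section ConeGeometry.
Variables (R : realType) (V : vectType R).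
Implicit Types (sigma tau rho : set V).

Lemma cone_span0 : cone_span [set (0 : V)] = 0%VS.
Proof.
apply/eqP; rewrite -subv0; apply/subvP => v /mem_cone_span; apply.
by move=> w ->; exact: mem0v.
Qed.

Lemma sub_cone_span sigma v : sigma v -> v \in cone_span sigma.
Proof. by move=> sv; apply/mem_cone_span => U; apply. Qed.

Lemma face_sub_face sigma tau rho : face tau sigma -> face rho sigma ->
  tau `<=` rho -> face tau rho.
Proof.
move=> [beta sb tE] fr tr; exists beta; first by move=> v /(face_subset fr)/sb.
rewrite tE in tr *; apply/seteqP; split=> v.
  by move=> tv; split; [exact: tr|case: tv].
by move=> [/(face_subset fr) sv bv].
Qed.

Lemma faceI sigma tau rho : face tau sigma -> face rho sigma -> face (tau `&` rho) sigma.
Proof.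
move=> [b sb ->] [c sc ->]; exists (b + c).
  by move=> v sv; rewrite /halfspace /= add_lfunE addr_ge0 //; [exact: sb|exact: sc].
apply/seteqP; split=> v /=.
  move=> [[sv bv] [_ cv]]; split=> //; move: bv cv; rewrite !memv_ker add_lfunE.
  by move=> /eqP -> /eqP ->; rewrite addr0.
move=> [sv]; rewrite !memv_ker add_lfunE => /eqP e.
have b0 := sb _ sv; have c0 := sc _ sv; rewrite /halfspace /= in b0 c0.
have /andP[/eqP bv /eqP cv] : ((b v : R) == 0) && ((c v : R) == 0).
  by rewrite -(paddr_eq0 b0 c0); apply/eqP.
by rewrite bv cv eqxx.
Qed.

Section Presentation.
Variables (n : nat) (alpha : 'I_n -> 'Hom(V, R^o)).
Let sigma : set V := [set v | forall i, halfspace (alpha i) v].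
Let sub_cone (J : {set 'I_n}) : set V :=
  sigma `&` [set v | forall i, i \in J -> (alpha i v : R) = 0].

Lemma presented_face (J : {set 'I_n}) : face (sub_cone J) sigma.
Proof.
have bE v : (\sum_(i in J) alpha i) v = \sum_(i in J) (alpha i v : R).
  by rewrite sum_lfunE.
exists (\sum_(i in J) alpha i).
  move=> v sv; rewrite /halfspace /= bE; apply: sumr_ge0 => i _; exact: sv.
apply/seteqP; split=> v [sv] /=; rewrite memv_ker bE; last first.
  move=> /eqP s0; split=> // i iJ; apply/eqP; move/eqP: s0.
  rewrite psumr_eq0 => [/allP/(_ i (mem_index_enum i))|j _]; last exact: sv.
  by rewrite iJ.
by move=> v0; split=> //; apply/eqP; rewrite big1.
Qed.

(* an interior point v0 of tau satisfies alpha i v0 > 0 unless alpha i vanishes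
   on tau; so N v0 - v lies in sigma for large N if v is in the right-hand side *)
Lemma face_presentation tau : face tau sigma -> exists J : {set 'I_n}, tau = sub_cone J.
Proof.
move=> [beta sb tE].
pose J : {set 'I_n} := [set i | `[< forall v, tau v -> (alpha i v : R) = 0 >]]%SET.
have JP i v : i \in J -> tau v -> (alpha i v : R) = 0 by rewrite inE => /asboolP; exact.
have s0 : sigma 0 by move=> i; rewrite /halfspace /= linear0.
have sD u v : sigma u -> sigma v -> sigma (u + v).
  by move=> su sv i; rewrite /halfspace /= linearD addr_ge0 //; [exact: su|exact: sv].
have t0 : tau 0 by rewrite tE; split=> //=; exact: mem0v.
have tD u v : tau u -> tau v -> tau (u + v).
  by rewrite tE => -[su bu] [sv bv]; split; [exact: sD|exact: memvD].
have exw i : exists w, tau w /\ (i \notin J -> 0 < (alpha i w : R)).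
  case: (boolP (i \in J)) => iJ; first by exists 0.
  have : ~ forall v, tau v -> (alpha i v : R) = 0 by move=> h; move: iJ; rewrite inE asboolT.
  move=> /existsNP[w /not_implyP[tw /eqP w0]]; exists w; split=> // _.
  by rewrite lt_neqAle eq_sym w0 /=; move: tw; rewrite tE => -[sw _]; exact: sw.
have [w hw] := choice exw.
pose v0 := \sum_i w i.
have tv0 : tau v0 by rewrite /v0; elim/big_ind: _ => // i _; case: (hw i).
have tsigma u : tau u -> sigma u by rewrite tE => -[].
have v0pos i : i \notin J -> 0 < (alpha i v0 : R).
  move=> iJ; rewrite /v0 linear_sum (bigD1 i) //=; apply: ltr_pwDl.
    by have [_] := hw i; exact.
  by apply: sumr_ge0 => j _; have [/tsigma tw _] := hw j; exact: tw.
exists J; apply/seteqP; split=> v.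
  by move=> tv; split; [exact: tsigma|move=> i iJ; exact: JP tv].
move=> [sv Jv]; rewrite tE; split=> //=; rewrite memv_ker eq_le.
pose N : R := \sum_(i | i \notin J) (alpha i v : R) / alpha i v0.
have : sigma (N *: v0 - v).
  move=> i; rewrite /halfspace /= linearB linearZ /= subr_ge0.
  case: (boolP (i \in J)) => iJ.
    by rewrite (Jv _ iJ) (JP _ _ iJ tv0) scaler0.
  rewrite -[_ *: _]/(N * (alpha i v0 : R)) -ler_pdivrMr ?v0pos //.
  rewrite /N (bigD1 i) //= lerDl; apply: sumr_ge0 => j /andP[jJ _].
  by apply: divr_ge0; [exact: sv|rewrite ltW // v0pos].
(* Since [beta] vanishes at [v0], its value at [N *: v0 - v] is [- beta v]; both signs being
   nonnegative, [beta v] is zero. *)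
move=> /sb; rewrite /halfspace /= linearB linearZ /=.
have -> : beta v0 = 0 by apply/eqP; rewrite -memv_ker; move: tv0; rewrite tE => -[].
rewrite scaler0 sub0r oppr_ge0 => -> /=; exact: sb.
Qed.

End Presentation.

(** Faces are parametrized by subsets of the finite index set of a presentation. *)
Lemma face_fan_finite sigma : is_cone sigma ->
  exists cones : seq (face_fan sigma), forall gamma, gamma \in cones.
Proof.
move=> [n [alpha [_ -> _]]].
set s := [set v | _].
have exF (J : {set 'I_n}) : exists gamma : face_fan s, val gamma =
    s `&` [set v | forall i, i \in J -> (alpha i v : R) = 0].
  by apply: set_type_elt; exact: presented_face.
have [F FE] := choice exF.
exists [seq F J | J <- enum {set 'I_n}] => gamma.
have [J gJ] := face_presentation (set_mem (valP gamma)).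
by apply/mapP; exists J; [rewrite mem_enum|apply: val_inj; rewrite FE gJ].
Qed.

Lemma face0 sigma : is_cone sigma -> face [set 0] sigma.
Proof.
move=> [n [alpha [_ -> ker0]]]; have := presented_face alpha [set: 'I_n]%SET.
congr face; apply/seteqP; split=> v.
  by move=> [_ hv]; apply: ker0 => i; rewrite memv_ker; apply/eqP/hv; rewrite inE.
by move=> ->; split=> [i|i _]; rewrite /halfspace /= linear0.
Qed.

(* these forms present the face where the alpha i, for i in J, vanish *)
Definition signed_forms n (alpha : 'I_n -> 'Hom(V, R^o)) (J : {set 'I_n})
    (k : 'I_(n + n)) : 'Hom(V, R^o) :=
  match fintype.split k with
  | inl i => alpha i
  | inr i => if i \in J then - alpha i else alpha i
  end.

Lemma signed_formsP n (alpha : 'I_n -> 'Hom(V, R^o)) (J : {set 'I_n}) :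
  [set v | forall i, halfspace (alpha i) v] `&`
    [set v | forall i, i \in J -> (alpha i v : R) = 0] =
  [set v | forall k, halfspace (signed_forms alpha J k) v].
Proof.
apply/seteqP; split=> v.
  move=> [sv Jv] k; rewrite /halfspace /= /signed_forms; case: (fintype.split k) => i; first exact: sv.
  case: ifP => iJ; last exact: sv.
  by rewrite opp_lfunE (Jv _ iJ) oppr0.
move=> gv; have sv i : 0 <= (alpha i v : R).
  by have := gv (lshift n i); rewrite /halfspace /= /signed_forms (unsplitK (inl _ i)).
split=> // i iJ; apply/eqP; rewrite eq_le sv andbT.
have := gv (rshift n i); rewrite /halfspace /= /signed_forms (unsplitK (inr _ i)) iJ.
by rewrite opp_lfunE oppr_ge0.
Qed.

Lemma face_cone sigma tau : is_cone sigma -> face tau sigma -> is_cone tau.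
Proof.
move=> [n [alpha [a0 -> ker0]]] /face_presentation[J ->].
rewrite signed_formsP.
exists (n + n)%N, (signed_forms alpha J); split=> //.
  move=> k; rewrite /signed_forms; case: (fintype.split k) => i //.
  by case: ifP => // _; rewrite oppr_eq0.
move=> v gv; apply: ker0 => i.
by have := gv (lshift n i); rewrite /signed_forms (unsplitK (inl _ i)).
Qed.

(** With faces described by the vanishing of presenting forms, a face of a face imposes further
    vanishing; a signed copy of a form vanishes exactly where the form does. *)
Lemma face_trans sigma tau rho : is_cone sigma -> face tau sigma -> face rho tau ->
  face rho sigma.
Proof.
move=> [n [alpha [_ -> _]]] /face_presentation[J ->].
rewrite signed_formsP => /face_presentation[J' ->].
rewrite -signed_formsP.
pose K : {set 'I_n} := (J :|: [set i | lshift n i \in J'] :|: [set i | rshift n i \in J'])%SET.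
have := presented_face alpha K; congr face.
apply/seteqP; split=> v.
  move=> [sv Kv]; split; first by split=> // i iJ; apply: Kv; rewrite !inE iJ.
  move=> k kJ'; rewrite /signed_forms; case: (fintype.splitP k) => i ki.
    have e : k = lshift n i by exact: val_inj.
    by apply: Kv; rewrite !inE -e kJ' orbT.
  have e : k = rshift n i by exact: val_inj.
  have v0 : (alpha i v : R) = 0 by apply: Kv; rewrite !inE -e kJ' orbT.
  by case: ifP => _ //; rewrite opp_lfunE v0 oppr0.
move=> [[sv Jv] J'v]; split=> // i; rewrite !inE -orbA => /or3P[iJ|iJ|iJ].
- exact: Jv.
- by have := J'v _ iJ; rewrite /signed_forms (unsplitK (inl _ i)).
- have := J'v _ iJ; rewrite /signed_forms (unsplitK (inr _ i)); case: ifP => // _.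
  by rewrite opp_lfunE => /eqP; rewrite oppr_eq0 => /eqP.
Qed.

End ConeGeometry.

Section Projection.
Variables (R : realType) (V W : vectType R) (sigma tau : set V) (p : 'Hom(V, W)).
Hypotheses (p_surj : limg p = fullv) (p_ker : lker p = cone_span tau).

Lemma proj_section w : p ((p^-1)%VF w) = w.
Proof. by apply: limg_lfunVK; rewrite p_surj memvf. Qed.

Lemma section_proj_ker v : (p^-1)%VF (p v) - v \in cone_span tau.
Proof. by rewrite -p_ker memv_ker linearB /= proj_section subrr. Qed.

Lemma proj_cone_span (X : set V) v : v \in cone_span X -> p v \in cone_span (p @` X).
Proof.
move=> /mem_cone_span vX; apply/mem_cone_span => U XU; rewrite memv_preim.
by apply: vX => x Xx /=; rewrite -memv_preim; apply: XU; exists x.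
Qed.

Lemma section_cone_span (X : set V) w : tau `<=` X -> w \in cone_span (p @` X) ->
  (p^-1)%VF w \in cone_span X.
Proof.
move=> tX /mem_cone_span/(_ (p @: cone_span X)%VS).
case/(_ _)/memv_imgP => [_ [x Xx <-]|v vX ->]; first exact/memv_img/sub_cone_span.
rewrite -[_ (p v)](subrK v); apply: memvD => //.
by apply: (subvP (cone_spanS tX)); exact: section_proj_ker.
Qed.

(** This is why the form of a face containing [tau] descends along [p]. *)
Lemma face_form_span (gamma : set V) (beta : 'Hom(V, R^o)) v :
  tau `<=` gamma -> gamma = sigma `&` [set v | v \in lker beta] ->
  v \in cone_span tau -> beta v = 0.
Proof.
move=> tg gE /mem_cone_span/(_ (lker beta)); rewrite memv_ker => h; apply/eqP/h.
by move=> w /tg; rewrite gE => -[].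
Qed.

(** Points with the same projection differ by an element of the span of [tau], on which the form of
    [gamma] vanishes; so a face containing [tau] is determined by its image. *)
Lemma proj_face_inj (gamma gamma' : set V) : face gamma sigma -> tau `<=` gamma ->
  gamma' `<=` sigma -> p @` gamma' `<=` p @` gamma -> gamma' `<=` gamma.
Proof.
move=> [beta sb gE] tg gs pg v gv.
have [|u gu puv] := pg (p v); first by exists v.
rewrite gE; split; first exact: gs.
have : beta (v - u) = 0.
  by apply: (face_form_span tg gE); rewrite -p_ker memv_ker linearB /= puv subrr.
rewrite /= memv_ker linearB /= => /eqP; rewrite subr_eq0 => /eqP ->.
by move: gu; rewrite gE => -[_ /=]; rewrite memv_ker.
Qed.

Lemma proj_face (gamma gamma' : set V) : face gamma sigma -> face gamma' sigma ->
  tau `<=` gamma' -> gamma' `<=` gamma -> face (p @` gamma') (p @` gamma).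
Proof.
move=> fg [beta sb gE] tg gg.
have bE v : (beta \o p^-1)%VF (p v) = beta v.
  rewrite comp_lfunE; apply/eqP; rewrite -subr_eq0 -linearB /=; apply/eqP.
  exact: (face_form_span tg gE (section_proj_ker v)).
exists (beta \o p^-1)%VF.
  by move=> _ [v gv <-]; rewrite /halfspace /= bE; apply: sb; exact: face_subset fg _ gv.
apply/seteqP; split=> [_ [v gv <-]|_ [[v gv <-]]] /=.
  split; first by exists v => //; exact: gg.
  by rewrite memv_ker bE -memv_ker; move: gv; rewrite gE => -[].
rewrite memv_ker bE -memv_ker => bv; exists v => //; rewrite gE; split=> //.
exact: face_subset fg _ gv.
Qed.

End Projection.

(** * The transversal inequality *)

Section SheafSystem.
Variables (R : realType) (V : vectType R) (Delta : set (set V)) (E : gsheaf Delta).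
Variables (I : Type) (lt : I -> I -> Prop) (g : I -> Delta).
Hypothesis g_face : forall i j, lt j i -> face (val (g j)) (val (g i)).

Definition sheaf_system : msystem R lt :=
  @MSystem R I lt (fun i => subvs_of (cone_span (val (g i)))) (fun i => E (g i))
    (fun i j => @to_face R V (val (g i)) (val (g j))) (fun i j => sheaf_res E (g i) (g j))
    (fun i j ji => res_twisted E (g_face ji)) (fun i j ji => res_graded (g_face ji))
    (fun i j k x ji kj => @sheaf_res_comp _ _ _ E (g i) (g j) (g k) (g_face ji) (g_face kj) x).

End SheafSystem.

Section Flabby.
Variables (R : realType) (V : vectType R) (Delta : set (set V)) (E : gsheaf Delta).
Variable cones : seq Delta.
Hypotheses (conesP : forall gamma, gamma \in cones) (minE : is_minimal_extension E).

(** Flabbiness of the whole sheaf, from [boundary_lift] at each cone outside [Lambda], in order of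
    dimension. *)
Lemma section_extension (Lambda : set Delta) (s : forall gamma, E gamma) :
  (forall gamma gamma' : Delta, Lambda gamma -> face (val gamma') (val gamma) ->
    Lambda gamma' /\ sheaf_res E gamma gamma' (s gamma) = s gamma') ->
  exists f : forall gamma, E gamma, (forall gamma, Lambda gamma -> f gamma = s gamma) /\
    forall gamma gamma', proper_face gamma' gamma -> sheaf_res E gamma gamma' (f gamma) = f gamma'.
Proof.
move=> sP.
pose r (gamma : Delta) := \dim (cone_span (val gamma)).
have rV gamma : (r gamma < (\dim {:V}).+1)%N by rewrite ltnS dimvS ?subvf.
have [|f hf] := @build_family Delta (fun gamma => E gamma) (fun=> 0) r _
  (fun gamma x => Lambda gamma -> x = s gamma)
  (fun gamma gamma' x x' => proper_face gamma' gamma -> sheaf_res E gamma gamma' x = x') rV.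
  move=> gamma f hf; case: (pselect (Lambda gamma)) => L.
    exists (s gamma); split=> // gamma' rg [fa _].
    by have [L' ->] := sP _ _ L fa; have [-> ] := hf _ rg.
  (* (LME) is silent about the zero cone, but no cone has smaller rank, so any value will do. *)
  case: (pselect (val gamma = [set 0])) => g0.
    have r0 : r gamma = 0%N by rewrite /r g0 cone_span0 dimv0.
    by exists 0; split=> // gamma'; rewrite r0.
  have [|y hy] := boundary_lift conesP minE g0 (f := f).
    move=> g1 g2 p1 p2 f21; case: (pselect (g2 = g1)) => [->|ne].
      exact: sheaf_res_id.
    have [_ h] := hf g1 (proper_face_dim p1).
    by apply: h => //; exact: proper_face_dim.
  by exists y; split=> // gamma' _; exact: hy.
exists f; split=> [gamma L|gamma gamma' pf].
  by have [h _] := hf gamma; exact: h.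
by have [_ h] := hf gamma; apply: h => //; exact: proper_face_dim.
Qed.

End Flabby.

Section TransversalStep.
Variables (R : realType) (V W : vectType R) (sigma tau : set V) (p : 'Hom(V, W)).
Hypotheses (p_surj : limg p = fullv) (p_ker : lker p = cone_span tau).
Variables (E : gsheaf (face_fan sigma)) (Delta' : set (set W)) (H : gsheaf Delta').
Variables (cones : seq (face_fan sigma)) (cones' : seq Delta').
Hypotheses (conesP : forall gamma, gamma \in cones) (conesP' : forall i, i \in cones').
Hypotheses (minE : is_minimal_extension E) (minH : is_minimal_extension H).
Variables (g : Delta' -> face_fan sigma) (o : Delta').
Hypotheses (g_img : forall i, val i = p @` val (g i)) (g_tau : forall i, face tau (val (g i)))
  (g_cap : forall i j, exists k, val (g k) = val (g i) `&` val (g j)) (g_o : val (g o) = tau) (tau0 : tau 0).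

Local Notation lt := (@proper_face _ _ Delta').

Let g_sigma i : face (val (g i)) sigma. Proof. exact: set_mem (valP (g i)). Qed.
Let tau_g i : tau `<=` val (g i). Proof. exact: face_subset. Qed.

(** The face order on the transversal fan is inclusion of the corresponding faces of [sigma]; this
    moves the combinatorics between the two fans. *)
Let face_gP i j : face (val j) (val i) <-> val (g j) `<=` val (g i).
Proof.
rewrite !g_img; split=> [/face_subset|].
  exact: (proj_face_inj p_ker (g_sigma i) (@tau_g i) (face_subset (g_sigma j))).
exact: (proj_face p_surj p_ker (g_sigma i) (g_sigma j) (@tau_g j)).
Qed.

Let g_face i j : lt j i -> face (val (g j)) (val (g i)).
Proof. by move=> [/face_gP ji _]; apply: face_sub_face ji; exact: g_sigma. Qed.

Let lt_trans i j k : lt j i -> lt k j -> lt k i.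
Proof.
move=> ji kj; split.
  apply/face_gP; apply: (@subset_trans _ (val (g j))).
    by apply/face_gP; case: kj.
  by apply/face_gP; case: ji.
move=> ki; have := ltn_trans (proper_face_dim kj) (proper_face_dim ji).
by rewrite ki ltnn.
Qed.

Let val_o : val o = [set 0].
Proof.
rewrite g_img g_o; apply/seteqP; split=> [_ [v tv <-]|_ ->] /=.
  by apply/eqP; rewrite -memv_ker p_ker; exact: sub_cone_span.
by exists 0; [exact: tau0|exact: linear0].
Qed.

Let not_lt_o j : ~ lt j o.
Proof.
by move=> /proper_face_dim; rewrite val_o cone_span0 dimv0.
Qed.

Let not_o i : i <> o -> val i <> [set 0].
Proof. by move=> io i0; apply: io; apply: val_inj; rewrite i0 val_o. Qed.

Local Notation HS := (@sheaf_system R W Delta' H Delta' lt id (fun i j ji => proj1 ji)).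
Local Notation ES := (@sheaf_system R V _ E Delta' lt g g_face).

Let lifts_HS i : i <> o -> boundary_lifts HS i.
Proof.
move=> io f hf; apply: (boundary_lift conesP' minH (not_o io)) => j k ji ki kj.
case: (pselect (k = j)) => [->|ne]; first exact: sheaf_res_id.
exact: (hf j k).
Qed.

(* a family on the faces of g i containing tau and different from g i extends,
   by restriction, to the faces of these; two such faces meet in a third one *)
Let lifts_ES i : boundary_lifts ES i.
Proof.
move=> f hf.
pose below (gamma : face_fan sigma) j := lt j i /\ face (val gamma) (val (g j)).
pose s (gamma : face_fan sigma) : E gamma :=
  if pselect (exists j, below gamma j) is left h
  then sheaf_res E (g (projT1 (cid h))) gamma (f (projT1 (cid h))) else 0.
have f_res j k : lt j i -> lt k i -> val (g k) `<=` val (g j) ->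
    sheaf_res E (g j) (g k) (f j) = f k.
  move=> ji ki /face_gP kj; case: (pselect (k = j)) => [->|ne]; first exact: sheaf_res_id.
  exact: (hf j k).
(* Independence of the chosen [j]: if [gamma] lies in [g j] and [g k], it lies in their
   intersection, which contains [tau] and is again indexed, and both restrictions factor through
   it. *)
have sE gamma j : below gamma j -> s gamma = sheaf_res E (g j) gamma (f j).
  move=> [ji gj]; rewrite /s; case: pselect => [h|]; last by case; exists j.
  case: (cid h) => k /= [ki gk]; have [l gl] := g_cap j k.
  have gamma_l : face (val gamma) (val (g l)).
    apply: face_sub_face (g_sigma l) _; first exact: set_mem (valP gamma).
    by rewrite gl => v gv; split; [exact: face_subset gj _ gv|exact: face_subset gk _ gv].
  have lj : val (g l) `<=` val (g j) by rewrite gl => v [].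
  have lk : val (g l) `<=` val (g k) by rewrite gl => v [].
  have li : lt l i.
    case: (pselect (l = j)) => [->//|ne]; apply: lt_trans ji _.
    by split=> //; apply/face_gP.
  have fl m : lt m i -> val (g l) `<=` val (g m) ->
      sheaf_res E (g m) gamma (f m) = sheaf_res E (g l) gamma (f l).
    move=> mi lm; rewrite -(f_res m l) // sheaf_res_comp //.
    by apply: face_sub_face lm; exact: g_sigma.
  by rewrite (fl k) // (fl j).
have [|F [FL FR]] := section_extension conesP minE
    (Lambda := fun gamma => exists j, below gamma j) (s := s).
  move=> gamma gamma' [j [ji gj]] gg'.
  have g'j : below gamma' j.
    split=> //; apply: face_sub_face (g_sigma j) _; first exact: set_mem (valP gamma').
    by move=> v /(face_subset gg')/(face_subset gj).
  split; first by exists j.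
  by rewrite (sE gamma' j) // (sE gamma j) // sheaf_res_comp.
exists (F (g i)) => j ji.
rewrite -[RHS](sheaf_res_id (f j)) -(sE (g j) j); last by split=> //; exact: face_refl.
rewrite -FL; last by exists j; split=> //; exact: face_refl.
apply: FR; split; first exact: g_face.
move=> e; have := proper_face_dim ji; rewrite !g_img e ltnn //.
Qed.

Local Notation VI i := (cone_span (val i)).

(** Pullback along [p] and along its section. The projections [vsproj] only adjust types, since
    these maps carry the span of [g i] into that of [i] and back. *)
Let theta i : {rmorphism polyfun (sspace HS i) -> polyfun (sspace ES i)} :=
  pullback (vsproj (VI i) \o p \o (vsval : subvs_of (VI (g i)) -> V)).
Let eta i : {rmorphism polyfun (sspace ES i) -> polyfun (sspace HS i)} :=
  pullback (vsproj (VI (g i)) \o p^-1%VF \o (vsval : subvs_of (VI i) -> W)).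

Lemma leq_bar_dim_transversal (i : Delta') (k : nat) :
  (\sum_(l < k.+1) bar_dim (@gmodule_deg _ _ (E (g o)) l%:Z) *
     bar_dim (@gmodule_deg _ _ (H i) (k - l)%N%:Z)
   <= bar_dim (@gmodule_deg _ _ (E (g i)) k%:Z))%N.
Proof.
have spanI (j : Delta') : cone_span (val j) = cone_span (p @` val (g j)) by rewrite -g_img.
have projP j (x : subvs_of (VI (g j))) : p (vsval x) \in VI j.
  by rewrite spanI; apply: proj_cone_span; exact: subvsP.
have secP j (x : subvs_of (VI j)) : p^-1%VF (vsval x) \in VI (g j).
  by apply: (section_cone_span p_surj p_ker (@tau_g j)); rewrite -spanI; exact: subvsP.
apply: (@leq_bar_dim_system R Delta' lt (fun j => \dim (VI j)) (\dim {:W}).+1 _ _ HS ES o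
  not_lt_o theta eta) => //.
- by move=> j; rewrite ltnS dimvS ?subvf.
- by move=> j l; exact: proper_face_dim.
- by move=> j q a; exact: homog_pullback.
- by move=> j q a; exact: homog_pullback.
- move=> j a; apply: polyfun_eq => x; congr (a _).
  rewrite /= vsprojK; last exact: secP.
  by rewrite (proj_section p_surj) vsvalK.
- move=> j l a lj; apply: polyfun_eq => x; congr (a _).
  rewrite /= vsprojK; last exact: projP.
  rewrite vsprojK //; apply: (subvP (cone_spanS _) _ (subvsP x)).
  by apply: face_subset; exact: g_face.
- move=> j l a lj; apply: polyfun_eq => x; congr (a _).
  rewrite /= vsprojK; last exact: secP.
  rewrite vsprojK //; apply: (subvP (cone_spanS _) _ (subvsP x)).
  by apply: face_subset; case: lj.
- by move=> j; exact: minimal_PF.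
- by move=> j; exact: minimal_PF.
- by move=> j x jo hx; apply: (boundary_ker conesP' minH (not_o jo)).
- by move=> j l x; exact: (stalk_bounded conesP' minH).
- by move=> j l; exact: (stalk_fin conesP' minH).
- by move=> j l; exact: (stalk_fin conesP minE).
- move=> a; apply: polyfun_eq => x; rewrite polyfunA; congr (a _).
  by apply: val_inj; apply/eqP; rewrite -memv0 -cone_span0 -val_o; exact: subvsP.
- by move=> j c; exact: pullbackA.
- by move=> a; congr (a _); rewrite /= !linear0.
- exact: minimal_N.
Qed.

End TransversalStep.

(** The isomorphism [u] kills $\mathfrak m M$ but takes the value 1 on the degree 0 component of
    [u' 1], which is therefore independent modulo $\mathfrak m M$. *)
Lemma iso_trivial_bar_dim (R : realType) (W : vectType R) (M : gmodule W) :
  iso_trivial M -> fin_deg M 0 -> (0 < bar_dim (@gmodule_deg R W M 0))%N.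
Proof.
move=> [u [[u' uK u'K] uZ udeg]] fM; pose x := gproj 0 (u' 1).
have uproj y : u (gproj 0 y) = u y.
  elim/gmodule_ind: y => [y z hy hz|k y hy]; first by rewrite gprojD !raddfD /= hy hz.
  case: (eqVneq k 0) => [k0|k0]; first by rewrite gproj_id // -k0.
  by rewrite (gproj_off hy) 1?eq_sym // raddf0 (udeg k).
have um y : max_mul y -> u y = 0.
  move: y; apply: max_mul_ind => [|y z hy hz|q a y q0 ha]; first exact: raddf0.
    by rewrite raddfD /= hy hz addr0.
  by rewrite uZ (homog_at0 ha) // mul0r.
rewrite -[X in (X <= _)%N](card_ord 1); apply: (leq_bar_dim (u := fun=> x)) => //.
  by move=> _; exact: gproj_deg.
move=> c; rewrite big_ord1 => /um; rewrite uZ uproj u'K polyfunA mulr1 => c0 i.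
by rewrite (ord1 i).
Qed.

Lemma poincare_odd (R : realType) (V : vectType R) (Delta : set (set V)) (E : gsheaf Delta) k :
  odd k -> poincare E k = 0%N.
Proof. by rewrite /poincare => ->. Qed.

Lemma poincare_top (R : realType) (V : vectType R) (Delta : set (set V)) (E : gsheaf Delta)
    (cones : seq Delta) (top : Delta) (k : nat) : (forall gamma, gamma \in cones) ->
  (forall gamma : Delta, face (val gamma) (val top)) ->
  poincare E k = if odd k then 0%N else bar_dim (@gmodule_deg _ _ (E top) k%:Z).
Proof.
move=> conesP topP; rewrite /poincare; case: ifP => // _.
exact: (@section_bar_dim R V Delta E cones conesP setT top I (fun gamma _ => topP gamma)).
Qed.

Lemma cone_origin (R : realType) (V : vectType R) (sigma : set V) : is_cone sigma -> sigma 0.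
Proof. by move=> [n [alpha [_ -> _]]] i; rewrite /halfspace /= linear0. Qed.

(* the transversal inequality for tau = {0} and p = id compares the given minimal
   extension sheaf on <tau> with the restriction of the one on <sigma> *)
Lemma leq_bar_dim_face (R : realType) (V : vectType R) (sigma tau : set V)
    (csigma : is_cone sigma) (ftau : face tau sigma)
    (E : gsheaf (face_fan sigma)) (E' : gsheaf (face_fan tau))
    (minE : is_minimal_extension E) (minE' : is_minimal_extension E')
    (t : face_fan sigma) (t' : face_fan tau) (k : nat) : val t = tau -> val t' = tau ->
  (bar_dim (@gmodule_deg _ _ (E' t') k%:Z) <= bar_dim (@gmodule_deg _ _ (E t) k%:Z))%N.
Proof.
move=> tE t'E; have ctau := face_cone csigma ftau.
have [cs csP] := face_fan_finite csigma; have [ct ctP] := face_fan_finite ctau.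
have fval (gamma : face_fan tau) : face (val gamma) tau := set_mem (valP gamma).
have exg (gamma : face_fan tau) : exists gamma' : face_fan sigma, val gamma' = val gamma.
  by apply: set_type_elt; exact: face_trans csigma ftau (fval gamma).
have [g gE] := choice exg.
have [o oE] := @set_type_elt _ (face_fan tau) _ (face0 ctau).
have -> : t = g t' by apply: val_inj; rewrite gE tE t'E.
have im1 (A : set V) : (\1%VF : 'Hom(V, V)) @` A = A.
  apply/seteqP; split=> [_ [v Av <-]|v Av]; first by rewrite id_lfunE.
  by exists v; rewrite ?id_lfunE.
have zface (gamma : face_fan tau) : face [set 0] (val gamma).
  by apply: face0; exact: face_cone ctau (fval gamma).
have lim1 : limg (\1%VF : 'Hom(V, V)) = fullv by rewrite lim1g.
have ker1 : lker (\1%VF : 'Hom(V, V)) = cone_span [set 0].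
  by rewrite cone_span0; apply/eqP/lker0P => u v; rewrite !id_lfunE.
have := @leq_bar_dim_transversal R V V sigma [set 0] \1%VF lim1 ker1 E (face_fan tau) E'
  cs ct csP ctP minE minE' g o _ _ _ _ _ t' k.
(* Only the term with [l = 0] is kept; its first factor belongs to the stalk at the zero cone and is
   at least 1. *)
rewrite big_ord_recl subn0 => H; apply: leq_trans (H _ _ _ _ _) => //.
- apply: leq_trans (leq_addr _ _); rewrite -[X in (X <= _)%N]mul1n leq_mul2r.
  apply/orP; right; apply: iso_trivial_bar_dim; last exact: (stalk_fin csP minE).
  by apply: minimal_N => //; rewrite gE oE.
- by move=> gamma; rewrite im1 gE.
- by move=> gamma; rewrite gE.
- move=> gamma gamma'.
  have [gamma'' e] := @set_type_elt _ (face_fan tau) _ (faceI (fval gamma) (fval gamma')).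
  by exists gamma''; rewrite !gE.
- by rewrite gE.
Qed.

Theorem theorem4p8 (R : realType) (V : vectType R) (sigma tau : set V)
    (hsigma : is_cone sigma) (htau : face tau sigma)
    (W : vectType R) (p : 'Hom(V, W))
    (p_surj : limg p = fullv) (p_ker : lker p = cone_span tau)
    (E_sigma : gsheaf (face_fan sigma))
    (hE_sigma : is_minimal_extension E_sigma)
    (E_tau : gsheaf (face_fan tau))
    (hE_tau : is_minimal_extension E_tau)
    (E_trans : gsheaf (transversal_fan p (face_fan sigma) tau))
    (hE_trans : is_minimal_extension E_trans) :
  forall k : nat,
    (\sum_(i < k.+1) poincare E_tau i * poincare E_trans (k - i)
       <= poincare E_sigma k)%N.
Proof.
have [cs csP] := face_fan_finite hsigma.
have [ct ctP] := face_fan_finite (face_cone hsigma htau).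
pose T := transversal_fan p (face_fan sigma) tau.
have [top topE] := @set_type_elt _ (face_fan sigma) sigma (face_refl sigma).
have [ttop ttopE] := @set_type_elt _ (face_fan tau) tau (face_refl tau).
have exg (i : T) : exists gamma : face_fan sigma,
    val i = p @` val gamma /\ face tau (val gamma).
  have [gamma [fg tg] <-] := set_mem (valP i).
  by have [g0 e] := set_type_elt fg; exists g0; rewrite e.
have [g gP] := choice exg.
have g_sigma i : face (val (g i)) sigma := set_mem (valP (g i)).
have g_ex (gamma : set V) : face gamma sigma -> face tau gamma ->
    exists i : T, val (g i) = gamma.
  move=> fg tg; have [|i iE] := @set_type_elt _ T (p @` gamma); first by exists gamma.
  exists i; have [ig tig] := gP i.
  apply/seteqP; split.
    apply: (proj_face_inj p_ker fg (face_subset tg) (face_subset (g_sigma i))).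
    by rewrite -ig iE.
  apply: (proj_face_inj p_ker (g_sigma i) (face_subset tig) (face_subset fg)).
  by rewrite -ig iE.
have [i_sigma sigmaE] := g_ex _ (face_refl sigma) htau.
have [i_tau tauE] := g_ex _ htau (face_refl tau).
(* A left inverse of [g], with [i_tau] as default off its image, transports the enumeration of the
   faces of [sigma] to the transversal fan. *)
have exh (gamma : face_fan sigma) : exists i : T, forall j, g j = gamma -> j = i.
  case: (pselect (exists i, g i = gamma)) => [[i gi]|no]; last first.
    by exists i_tau => j gj; case: no; exists j.
  by exists i => j gj; apply: val_inj; rewrite (gP i).1 (gP j).1 gi gj.
have [h hP] := choice exh.
have hsP i : i \in [seq h gamma | gamma <- cs].
  by apply/mapP; exists (g i); [exact: csP|exact: hP].
have g_cap i j : exists l, val (g l) = val (g i) `&` val (g j).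
  apply: g_ex; first exact: faceI.
  apply: (face_sub_face htau (faceI (g_sigma i) (g_sigma j))) => v tv.
  by split; [exact: face_subset (gP i).2 _ tv|exact: face_subset (gP j).2 _ tv].
have trans_top (gamma : T) : face (val gamma) (val i_sigma).
  rewrite (gP gamma).1 (gP i_sigma).1; apply: (proj_face p_surj p_ker) => //.
    exact: face_subset (gP gamma).2.
  by rewrite sigmaE; exact: face_subset.
have tau_top (gamma : face_fan tau) : face (val gamma) (val ttop).
  by rewrite ttopE; exact: set_mem (valP gamma).
have sigma_top (gamma : face_fan sigma) : face (val gamma) (val (g i_sigma)).
  by rewrite sigmaE; exact: set_mem (valP gamma).
move=> k; rewrite (poincare_top _ _ csP sigma_top).
have leE l : (poincare E_tau l * poincare E_trans (k - l) <=
    bar_dim (@gmodule_deg _ _ (E_sigma (g i_tau)) l%:Z) *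
    bar_dim (@gmodule_deg _ _ (E_trans i_sigma) (k - l)%N%:Z))%N.
  rewrite (poincare_top _ _ ctP tau_top) (poincare_top _ _ hsP trans_top).
  apply: leq_mul; case: ifP => // _.
  exact: (leq_bar_dim_face hsigma htau hE_sigma hE_tau).
(* For odd [k] the right-hand side is 0 by convention, and so is each product, because [l] or
   [k - l] is odd. *)
case: ifP => kodd.
  rewrite leqn0; apply/eqP; apply: big1 => l _.
  have lk : (l <= k)%N by rewrite -ltnS ltn_ord.
  have := oddB lk; rewrite kodd; case: (boolP (odd l)) => lodd klodd.
    by rewrite poincare_odd // mul0n.
  by rewrite [X in (_ * X)%N]poincare_odd // muln0.
apply: leq_trans; first by apply: leq_sum => l _; exact: leE.
apply: (@leq_bar_dim_transversal R V W sigma tau p p_surj p_ker E_sigma T E_trans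
  cs _ csP hsP hE_sigma hE_trans g i_tau).
- by move=> i; case: (gP i).
- by move=> i; case: (gP i).
- exact: g_cap.
- exact: tauE.
- exact: cone_origin (face_cone hsigma htau).
Qed.
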